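(* Let $n \ge 3$ and let $\mathcal Z : \mathrm{LC}(\mathbb R^n;(0,\infty)) \to F(\mathbb R^n;\mathbb R)$ be a map. Then $\mathcal Z$ is a continuous and $\mathrm{SL}(n)$ covariant valuation which is a translation homomorphism on log-concave functions if and only if there is a constant $c \in \mathbb R$ such that $$\mathcal Z f = c f$$ for every $f \in \mathrm{LC}(\mathbb R^n;(0,\infty))$.
   Context: $\mathrm{LC}(\mathbb R^n;(0,\infty))=\{e^{-u}: u:\mathbb R^n\to\mathbb R \text{ convex (finite)}\}$. $F(\mathbb R^n;\mathbb R)$ is the set of all functions $\mathbb R^n\to\mathbb R$. $f\vee g$ and $f\wedge g$ denote pointwise maximum and minimum. $\mathcal Z$ is a valuation if $\mathcal Z(f\vee g)+\mathcal Z(f\wedge g)=\mathcal Z f+\mathcal Z g$ whenever $f,g,f\vee g,f\wedge g\in \mathrm{LC}(\mathbb R^n;(0,\infty))$. $\mathcal Z$ is continuous if hypo-convergence $f_i\to f$ in $\mathrm{LC}(\mathbb R^n;(0,\infty))$ implies $\mathcal Z f_i\to\mathcal Z f$ pointwise; hypo-convergence of $f_i$ to $f$ means that $u_i=-\log f_i$ epi-converges to $u=-\log f$, i.e. for every $x\in\mathbb R^n$, $u(x)\le\liminf_i u_i(x_i)$ for all $x_i\to x$, and there is a sequence $x_i\to x$ with $u(x)=\lim_i u_i(x_i)$. $\mathcal Z$ is $\mathrm{SL}(n)$ covariant if $\mathcal Z(f\circ\phi^{-1})=(\mathcal Z f)\circ\phi^{-1}$ for all $f$ and all $\phi\in \mathrm{SL}(n)$.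 For $y\in\mathbb R^n$ write $\tau_y f(x)=f(x-y)$ and $\ell_y(x)=x\cdot y$. $\mathcal Z$ is a translation homomorphism on log-concave functions if $\mathcal Z(\tau_y f)=\tau_y\mathcal Z(f)$ and $\mathcal Z(e^{-\ell_y}f)=e^{-\ell_y}\mathcal Z(f)$ for all $f\in \mathrm{LC}(\mathbb R^n;(0,\infty))$ and $y\in\mathbb R^n$. *)

(* Defs.v *)
From mathcomp Require Import all_boot all_order all_algebra.
From mathcomp Require Import all_classical all_reals all_analysis.

Set Implicit Arguments.
Unset Strict Implicit.
Unset Printing Implicit Defensive.
Import Order.TTheory GRing.Theory Num.Theory.
Import numFieldNormedType.Exports.
Local Open Scope classical_set_scope.
Local Open Scope ring_scope.

(* R^n is the type of column vectors ['cV[R]_n], so that a matrix [phi] acts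
   by [phi *m x].  Only its (product) topology is used below. *)

Definition dot (R : realType) (n : nat) (x y : 'cV[R]_n) : R :=
  \sum_(i < n) x i 0 * y i 0.

(* [u] is real-valued, hence everywhere finite. *)
Definition log_concave (R : realType) (n : nat) (f : 'cV[R]_n -> R) : Prop :=
  exists2 u : 'cV[R]_n -> R,
    @convex_function R 'cV[R]_n [set: 'cV[R]_n] u &
    f = (fun x => expR (- u x)).

(* LC(R^n; (0, oo)) *)
Record LC (R : realType) (n : nat) := MkLC {
  LC_fun :> 'cV[R]_n -> R;
  LC_funP : log_concave LC_fun
}.

Definition translate (R : realType) (n : nat) (y : 'cV[R]_n)
  (f : 'cV[R]_n -> R) : 'cV[R]_n -> R := fun x => f (x - y).

(* multiplication by exp(- l_y), where l_y(x) = x . y *)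
Definition tilt (R : realType) (n : nat) (y : 'cV[R]_n)
  (f : 'cV[R]_n -> R) : 'cV[R]_n -> R := fun x => expR (- dot x y) * f x.

(* f o phi^-1 *)
Definition comp_inv (R : realType) (n : nat) (phi : 'M[R]_n)
  (f : 'cV[R]_n -> R) : 'cV[R]_n -> R := fun x => f (invmx phi *m x).

Lemma translate_LC (R : realType) (n : nat) (y : 'cV[R]_n) (f : LC R n) :
  log_concave (translate y f).
Proof.
case: f => f /= [u cu ->]; exists (fun x => u (x - y)) => // t a b aT bT.
have convB (s : R) (v w : 'cV[R]_n) : s *: v + (1 - s) *: w - y
    = s *: (v - y) + (1 - s) *: (w - y).
  rewrite !scalerBr addrACA -opprD -scalerDl.
  by rewrite (addrC s) subrK scale1r.
rewrite [X in u X](convB t%:num a b).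
by apply: cu; rewrite inE.
Qed.

Lemma tilt_LC (R : realType) (n : nat) (y : 'cV[R]_n) (f : LC R n) :
  log_concave (tilt y f).
Proof.
case: f => f /= [u cu ->]; exists (fun x => dot x y + u x); last first.
  by apply/funext => x; rewrite /tilt opprD expRD.
move=> t a b aT bT; have := cu t a b aT bT.
have -> : dot (conv t (a : convex_lmodType 'cV[R]_n) b) y
    = t%:inum * dot a y + (1 - t%:inum) * dot b y.
  rewrite /dot !mulr_sumr -big_split/=; apply: eq_bigr => i _.
  by rewrite !mxE mulrDl !mulrA.
by rewrite !convRE !mulrDr addrACA lerD2l.
Qed.

Lemma comp_inv_LC (R : realType) (n : nat) (phi : 'M[R]_n) (f : LC R n) :
  log_concave (comp_inv phi f).
Proof.
case: f => f /= [u cu ->]; exists (fun x => u (invmx phi *m x)) => // t a b aT bT.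
have -> : invmx phi *m conv t (a : convex_lmodType 'cV[R]_n) b
    = conv t (invmx phi *m a : convex_lmodType 'cV[R]_n) (invmx phi *m b).
  by rewrite mulmxDr -!scalemxAr.
by apply: cu; rewrite inE.
Qed.

(* The liminf is taken in the extended reals: the real-valued [limn_inf] is
   meaningless for unbounded sequences. *)
Definition epi_cvg (R : realType) (n : nat)
    (u_ : nat -> 'cV[R]_n -> R) (u : 'cV[R]_n -> R) : Prop :=
  forall x : 'cV[R]_n,
    (forall x_ : nat -> 'cV[R]_n, x_ @ \oo --> x ->
       ((u x)%:E <= limn_einf (fun i => (u_ i (x_ i))%:E))%E) /\
    (exists2 x_ : nat -> 'cV[R]_n, x_ @ \oo --> x &
       (fun i => u_ i (x_ i)) @ \oo --> u x).

Definition hypo_cvg (R : realType) (n : nat)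
    (f_ : nat -> LC R n) (f : LC R n) : Prop :=
  epi_cvg (fun i x => - ln (f_ i x)) (fun x => - ln (f x)).

Definition valuation (R : realType) (n : nat)
    (Z : LC R n -> 'cV[R]_n -> R) : Prop :=
  forall (f g : LC R n)
    (fg_max : log_concave (fun x => Num.max (f x) (g x)))
    (fg_min : log_concave (fun x => Num.min (f x) (g x))) (x : 'cV[R]_n),
    Z (MkLC fg_max) x + Z (MkLC fg_min) x = Z f x + Z g x.

Definition hypo_continuous (R : realType) (n : nat)
    (Z : LC R n -> 'cV[R]_n -> R) : Prop :=
  forall (f_ : nat -> LC R n) (f : LC R n), hypo_cvg f_ f ->
    forall x : 'cV[R]_n, (fun i => Z (f_ i) x) @ \oo --> Z f x.

Definition SL_covariant (R : realType) (n : nat)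
    (Z : LC R n -> 'cV[R]_n -> R) : Prop :=
  forall (f : LC R n) (phi : 'M[R]_n), \det phi = 1 ->
    Z (MkLC (comp_inv_LC phi f)) = comp_inv phi (Z f).

Definition translation_hom (R : realType) (n : nat)
    (Z : LC R n -> 'cV[R]_n -> R) : Prop :=
  forall (f : LC R n) (y : 'cV[R]_n),
    Z (MkLC (translate_LC y f)) = translate y (Z f) /\
    Z (MkLC (tilt_LC y f)) = tilt y (Z f).

(* Main.v *)
From HB Require Import structures.
Require Import Defs.
From mathcomp Require Import all_boot all_order all_algebra.
From mathcomp Require Import all_classical all_reals all_analysis.
From mathcomp Require Import ring lra.
Set Implicit Arguments.
Unset Strict Implicit.
Unset Printing Implicit Defensive.
Import Order.TTheory GRing.Theory Num.Theory.
Import numFieldNormedType.Exports.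
Local Open Scope classical_set_scope.
Local Open Scope ring_scope.

(** Write [f = expR (- u)] with [u] convex and put [mu u = Z f 0]. The two
    translation properties say that [Z] is determined by [mu], that [mu] does
    not change when a linear function is added to [u], and that adding the
    constant [h] multiplies [mu u] by [expR (- h)]. The functional
    [u |-> expR (- u 0)] has all the properties of [mu]; subtracting
    the right multiple of it, one may assume that [mu] vanishes at the zero
    function, and the claim becomes [mu = 0].

    Every finite convex function is a limit of maxima of finitely many affine
    functions (tangents at rational points, [mu_cvx0]), so it suffices to treat
    such maxima. The picture to keep in mind is the Legendre dual: a maximum
    of affine functions is a convex function on the polytope spanned by
    the slopes, with value minus the height at each slope, and [mu] is a
    translation and SL(n) invariant valuation of this dual function. The
    valuation property is used only to cut: if [q] is a convex combination of
    [a] and [b], then [mu_split] relates [max(a, b, rest)] to [max(q, b, rest)],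
    [max(a, q, rest)] and [max(q, rest)].

    - Degenerate maxima ([mu_simplex_det0], [mu_maxaff_small]). If the slopes
      do not affinely span the space, then elements of SL(n) contract all slope
      differences to zero, and continuity gives [mu = 0]. Hence the term
      [max(q, rest)] drops out whenever it consists of at most [n] functions:
      cutting is additive.

    - Simplices with a coincidence ([mu_simplex_coincidence_gt0]). Take
      [n + 1] affine functions, two of which have equal heights and one of which
      has a height strictly below all the others. Cutting the edge between
      the two equal heights in the middle produces two simplices of half the
      volume and with the same heights, so [mu] is linear in the volume as long
      as the heights are fixed. On the other hand, cutting the edges at the
      lowest vertex exhibits a small simplex as what remains of a big one
      after [n] pieces are cut off; on all of these [mu], by continuity, is at
      most [C expR (- l B)] in absolute value, where [1 / l] is the ratio of the two
      sizes and [B > 0] the height gap ([mu_small_simplex_bound]).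
      The exponential beats the volume factor [l ^ n], so [mu] vanishes.

    - All simplices ([mu_maxaff_succ]). Set aside a lowest vertex; among the
      remaining [n >= 3] ones choose three, of heights [a <= b <= c], and cut the
      edge from [a] to [c] at height [b]: both pieces have a coincidence.

    - All maxima ([mu_maxaff_relation], [mu_maxaff0]). More than [n + 1] slopes
      satisfy a Radon relation. Merging, by cuts, the functions on one side of it
      into a single one makes that function redundant, and the number of
      functions drops.

    In the converse direction only the continuity needs an argument:
    epi-convergence of finite convex functions implies pointwise convergence
    ([cvx_pointwise_cvg]), since subgradients are bounded where the functions
    are. *)

(** * Affine functions and their maxima *)

Record aff (R : realType) (n : nat) := Aff { slope : 'rV[R]_n; height : R }.

Section AffModule.
Context {R : realType} {n : nat}.
Implicit Types a b c : aff R n.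

Let pair_of a := (slope a, height a).
Let of_pair (p : 'rV[R]_n * R) := Aff p.1 p.2.
Let pair_ofK : cancel pair_of of_pair. Proof. by case. Qed.

HB.instance Definition _ := Choice.copy (aff R n) (can_type pair_ofK).

Let add a b := Aff (slope a + slope b) (height a + height b).
Let opp a := Aff (- slope a) (- height a).
Let scale (t : R) a := Aff (t *: slope a) (t * height a).

Let addA : associative add.
Proof. by move=> a b c; rewrite /add !addrA. Qed.
Let addC : commutative add.
Proof. by move=> a b; congr Aff; rewrite addrC. Qed.
Let add0 : left_id (Aff 0 0) add.
Proof. by move=> [g c]; congr Aff; rewrite /= add0r. Qed.
Let addN : left_inverse (Aff 0 0) opp add.
Proof. by move=> [g c]; congr Aff; rewrite /= addNr. Qed.

HB.instance Definition _ := GRing.isZmodule.Build (aff R n) addA addC add0 addN.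

Let scaleA s t a : scale s (scale t a) = scale (s * t) a.
Proof. by congr Aff; rewrite /= ?scalerA ?mulrA. Qed.
Let scale1 : left_id 1 scale.
Proof. by move=> [g c]; congr Aff; rewrite /= ?scale1r ?mul1r. Qed.
Let scaleDr : right_distributive scale +%R.
Proof. by move=> t a b; congr Aff; rewrite /= ?scalerDr ?mulrDr. Qed.
Let scaleDl a s t : scale (s + t) a = scale s a + scale t a.
Proof. by congr Aff; rewrite /= ?scalerDl ?mulrDl. Qed.

HB.instance Definition _ :=
  GRing.Zmodule_isLmodule.Build R (aff R n) scaleA scale1 scaleDr scaleDl.

End AffModule.

Section Convex.
Context {R : realType} {n : nat}.
Implicit Types (u v : 'cV[R]_n -> R) (x y : 'cV[R]_n).

Definition cvx u := forall (t : R) x y, 0 <= t <= 1 ->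
  u (t *: x + (1 - t) *: y) <= t * u x + (1 - t) * u y.

Implicit Types (a b : aff R n) (s : seq (aff R n)).

Definition ev a x : R := (slope a *m x) 0 0 + height a.

Lemma evD a b x : ev (a + b) x = ev a x + ev b x.
Proof. by rewrite /ev mulmxDl mxE addrACA. Qed.

Lemma evZ (t : R) a x : ev (t *: a) x = t * ev a x.
Proof. by rewrite /ev -scalemxAl mxE mulrDr. Qed.

Lemma ev0 x : ev 0 x = 0.
Proof. by rewrite /ev mul0mx mxE addr0. Qed.

Lemma ev_cst (c : R) x : ev (Aff 0 c) x = c.
Proof. by rewrite /ev mul0mx mxE add0r. Qed.

Lemma ev_conv a (t : R) x y :
  ev a (t *: x + (1 - t) *: y) = t * ev a x + (1 - t) * ev a y.
Proof.
rewrite /ev mulmxDr -!scalemxAr mxE [X in X + _ + _]mxE [X in _ + X + _]mxE; ring.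
Qed.

Lemma cvx_ev a : cvx (ev a).
Proof. by move=> t x y _; rewrite ev_conv. Qed.

Lemma cvx_add u v : cvx u -> cvx v -> cvx (fun x => u x + v x).
Proof.
move=> cu cv t x y t01; apply: le_trans (lerD (cu t x y t01) (cv t x y t01)) _.
by rewrite le_eqVlt; apply/orP; left; apply/eqP; ring.
Qed.

Lemma cvx_max u v : cvx u -> cvx v -> cvx (fun x => Num.max (u x) (v x)).
Proof.
move=> cu cv t x y t01; have /andP[t0 t1] := t01.
rewrite ge_max; apply/andP; split.
  apply: le_trans (cu t x y t01) _.
  by apply: lerD; apply: ler_wpM2l; rewrite ?subr_ge0// le_max lexx.
apply: le_trans (cv t x y t01) _.
by apply: lerD; apply: ler_wpM2l; rewrite ?subr_ge0// le_max lexx orbT.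
Qed.

Lemma cvx_comp u (phi : 'M[R]_n) : cvx u -> cvx (fun x => u (phi *m x)).
Proof.
by move=> cu t x y t01; rewrite mulmxDr -!scalemxAr; exact: cu.
Qed.

(** The default is an element of the list, hence neutral unless [s] is empty. *)
Definition maxaff s x : R := \big[Num.max/ev (head 0 s) x]_(a <- s) ev a x.

(** With [maxaff_ge] this characterizes the maximum of a nonempty list, whatever
    the order and multiplicity of its elements. *)
Lemma maxaff_attained s x : s != [::] ->
  exists2 a, a \in s & maxaff s x = ev a x.
Proof.
case: s => // b s _; rewrite /maxaff big_seq.
apply: (big_ind (fun m => exists2 a, a \in b :: s & m = ev a x)).
- by exists b; rewrite // inE eqxx.
- move=> _ _ [a aS ->] [c cS ->]; case: (leP (ev a x) (ev c x)) => _.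
    by exists c.
  by exists a.
- by move=> a aS; exists a.
Qed.

Lemma maxaff_ge s x a : a \in s -> ev a x <= maxaff s x.
Proof. by move=> aS; rewrite /maxaff; apply: (@bigmax_sup_seq _ _ _ _ _ a). Qed.

Lemma maxaff_le s x (r : R) : s != [::] ->
  (maxaff s x <= r) = all (fun a => ev a x <= r) s.
Proof.
move=> s0; apply/idP/allP => [h a /maxaff_ge aS|]; first exact: le_trans h.
by have [a aS ->] := maxaff_attained x s0; apply.
Qed.

Lemma eq_maxaff s s' : s =i s' -> maxaff s = maxaff s'.
Proof.
move=> ss'; apply/funext => x.
case: s s' ss' => [|c s] [|c' s'] ss' //; first by have := ss' c'; rewrite mem_head.
  by have := ss' c; rewrite mem_head.
apply/eqP; rewrite eq_le !maxaff_le//; apply/andP; split; apply/allP => a aS.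
  by apply: maxaff_ge; rewrite -ss'.
by apply: maxaff_ge; rewrite ss'.
Qed.

Lemma maxaff1 a x : maxaff [:: a] x = ev a x.
Proof.
by have [b] := @maxaff_attained [:: a] x isT; rewrite inE => /eqP ->.
Qed.

Lemma maxaff_cons a s x : s != [::] ->
  maxaff (a :: s) x = Num.max (ev a x) (maxaff s x).
Proof.
move=> s0; apply/eqP; rewrite eq_le maxaff_le//= le_max lexx/=.
apply/andP; split.
  by apply/allP => b bS; rewrite le_max maxaff_ge ?orbT.
rewrite ge_max maxaff_ge ?inE ?eqxx//= maxaff_le//.
by apply/allP => b bS; rewrite maxaff_ge// inE bS orbT.
Qed.

Lemma cvx_maxaff s : cvx (maxaff s).
Proof.
have [->|s0] := eqVneq s [::].
  by move=> t x y _; rewrite /maxaff !big_nil/= ev_conv.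
elim: s s0 => // a s ih _; have [->|s0] := eqVneq s [::].
  have -> : maxaff [:: a] = ev a by apply/funext => x; rewrite maxaff1.
  exact: cvx_ev.
have -> : maxaff (a :: s) = fun x => Num.max (ev a x) (maxaff s x).
  by apply/funext => x; rewrite maxaff_cons.
by apply: cvx_max; [exact: cvx_ev | exact: ih].
Qed.

Lemma maxaff_addr s b x : s != [::] ->
  maxaff [seq a + b | a <- s] x = maxaff s x + ev b x.
Proof.
move=> s0; apply/eqP; rewrite eq_le; apply/andP; split.
  rewrite maxaff_le ?map_eq0//; first by apply/allP => _ /mapP[a aS ->];
    rewrite evD lerD2r maxaff_ge.
  by case: s s0.
have [a aS ->] := maxaff_attained x s0.
by rewrite -evD; apply: maxaff_ge; apply: map_f.
Qed.

End Convex.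

(** * Invariant valuations and cuts *)

Section Valuation.
Context {R : realType} {n : nat}.
Implicit Types (u v : 'cV[R]_n -> R) (mu : ('cV[R]_n -> R) -> R).
Implicit Types (a b : aff R n) (s : seq (aff R n)).

(** The properties of [u |-> Z (expR (- u)) 0]. Continuity is required along
    sequences with [u_ m (x_ m) --> u x] whenever [x_ m --> x], that is, along
    locally uniformly convergent sequences; on finite convex functions this
    is the same as epi-convergence. *)
Record invariant_valuation mu : Prop := {
  iv_affine : forall u a, cvx u ->
    mu (fun x => u x + ev a x) = expR (- height a) * mu u;
  iv_SL : forall u (phi : 'M[R]_n), cvx u -> \det phi = 1 ->
    mu (fun x => u (phi *m x)) = mu u;
  iv_val : forall u v, cvx u -> cvx v ->
    cvx (fun x => Num.min (u x) (v x)) ->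
    mu (fun x => Num.max (u x) (v x)) + mu (fun x => Num.min (u x) (v x)) =
    mu u + mu v;
  iv_cts : forall (u_ : nat -> 'cV[R]_n -> R) u,
    (forall m, cvx (u_ m)) -> cvx u ->
    (forall x_ x, x_ @ \oo --> x -> (fun m => u_ m (x_ m)) @ \oo --> u x) ->
    (fun m => mu (u_ m)) @ \oo --> mu u }.

Context (mu : ('cV[R]_n -> R) -> R) (muP : invariant_valuation mu)
  (mu0 : mu (fun=> 0) = 0).

(** [A], [B], [Q], [M] stand for the values, at one point, of the functions [a], [b],
    [q] and of the maximum of [s] in [mu_split]. *)
Lemma max_min_cut (A B Q M : R) : (A <= Q <= B) || (B <= Q <= A) ->
  Num.max A (Num.max B M) =
    Num.max (Num.max Q (Num.max B M)) (Num.max A (Num.max Q M)) /\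
  Num.max Q M = Num.min (Num.max Q (Num.max B M)) (Num.max A (Num.max Q M)).
Proof.
have maxP (x y : R) : (y <= x /\ Num.max x y = x) \/ (x <= y /\ Num.max x y = y).
  by case: (leP x y) => [|/ltW] ?; [right | left].
have minP (x y : R) : (y <= x /\ Num.min x y = y) \/ (x <= y /\ Num.min x y = x).
  by case: (leP x y) => [|/ltW] ?; [right | left].
by case/orP=> /andP[? ?]; split;
  repeat match goal with
  | |- context [Num.max ?x ?y] => is_var x; is_var y; case: (maxP x y) => -[? ->]
  | |- context [Num.min ?x ?y] => is_var x; is_var y; case: (minP x y) => -[? ->]
  end; lra.
Qed.

(** The point [q] lies between [a] and [b] at every argument, so the two pieces
    [max(q, b, s)] and [max(a, q, s)] have the uncut function as their maximum and
    [max(q, s)] as their minimum. *)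
Lemma mu_split a b s (t : R) : 0 <= t <= 1 ->
  let q := t *: a + (1 - t) *: b in
  s != [::] ->
  mu (maxaff [:: a, b & s]) + mu (maxaff (q :: s)) =
  mu (maxaff [:: q, b & s]) + mu (maxaff [:: a, q & s]).
Proof.
move=> t01 q s0.
have h x : (ev a x <= ev q x <= ev b x) || (ev b x <= ev q x <= ev a x).
  rewrite [ev q x]evD !evZ; have /andP[t0 t1] := t01.
  have t1' : 0 <= 1 - t by rewrite subr_ge0.
  have [ab|/ltW ab] := leP (ev a x) (ev b x); apply/orP; [left|right];
    have := mulr_ge0 t0 (etrans (subr_ge0 _ _) ab);
    have := mulr_ge0 t1' (etrans (subr_ge0 _ _) ab) => *; apply/andP; split; lra.
have e1 : maxaff [:: a, b & s] = (fun x =>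
    Num.max (maxaff [:: q, b & s] x) (maxaff [:: a, q & s] x)).
  by apply/funext => x; rewrite !maxaff_cons//; have [] := max_min_cut (maxaff s x) (h x).
have e2 : maxaff (q :: s) = (fun x =>
    Num.min (maxaff [:: q, b & s] x) (maxaff [:: a, q & s] x)).
  by apply/funext => x; rewrite !maxaff_cons//; have [] := max_min_cut (maxaff s x) (h x).
rewrite e1 e2 (iv_val muP)//; try exact: cvx_maxaff.
by rewrite -e2; exact: cvx_maxaff.
Qed.

End Valuation.

(** * Limits of maxima of affine functions *)

Lemma seq_argmax (R : realDomainType) (T : eqType) (f : T -> R) (s : seq T) :
  s != [::] -> exists2 d, d \in s & forall e, e \in s -> f e <= f d.
Proof.
elim: s => // a s ih _; have [->|s0] := eqVneq s [::].
  by exists a => [|e]; rewrite ?mem_head// inE => /eqP ->.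
have [d ds dmax] := ih s0; have [le|/ltW le] := leP (f a) (f d).
  exists d => [|e]; rewrite inE ?ds ?orbT// => /predU1P[->//|]; exact: dmax.
exists a => [|e]; rewrite inE ?eqxx// => /predU1P[->//|/dmax h].
exact: le_trans h le.
Qed.

Lemma det0_dim (R : realType) (k : nat) (Q : 'M[R]_k) :
  \det Q = 0 -> (0 < k)%N.
Proof.
by case: k Q => // Q; rewrite det_mx00 => /eqP; rewrite oner_eq0.
Qed.

Section Limits.
Context {R : realType} {n : nat}.

Lemma cvg_mulrv (p : 'rV[R]_n) (x_ : nat -> 'cV[R]_n) (x : 'cV[R]_n) :
  x_ @ \oo --> x -> (fun m => (p *m x_ m) 0 0) @ \oo --> (p *m x) 0 0.
Proof.
move=> xx; rewrite [X in _ --> X]mxE.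
rewrite (_ : (fun m => _) = (fun m => \sum_j p 0 j * x_ m j 0)); last first.
  by apply/funext => m; rewrite mxE.
apply: cvg_big => [|i _]; first exact: add_continuous.
apply: cvgM; first exact: cvg_cst.
exact: (cvg_comp _ _ xx (@coord_continuous _ _ _ i 0 x)).
Qed.

Lemma cvg_maxr (f g : nat -> R) (a b : R) : f @ \oo --> a -> g @ \oo --> b ->
  (fun m => Num.max (f m) (g m)) @ \oo --> Num.max a b.
Proof.
move=> fa gb; rewrite maxr_absE.
rewrite (_ : (fun m => _) =
    (fun m => (f m + g m + `|f m - g m|) / 2)); last first.
  by apply/funext => m; rewrite maxr_absE.
apply: cvgM; last exact: cvg_cst.
by apply: cvgD; [exact: cvgD | apply: cvg_norm; exact: cvgB].
Qed.

Lemma cvg_maxaff (I : eqType) (s : seq I) (f : nat -> I -> aff R n)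
    (g : I -> aff R n) (x_ : nat -> 'cV[R]_n) (x : 'cV[R]_n) :
  s != [::] ->
  (forall i, i \in s -> (fun m => ev (f m i) (x_ m)) @ \oo --> ev (g i) x) ->
  (fun m => maxaff [seq f m i | i <- s] (x_ m)) @ \oo -->
  maxaff [seq g i | i <- s] x.
Proof.
elim: s => // i s ih _ h; have [->|s0] := eqVneq s [::].
  rewrite maxaff1 (_ : (fun m => _) = (fun m => ev (f m i) (x_ m))).
    by apply: h; rewrite mem_head.
  by apply/funext => m; rewrite maxaff1.
rewrite [map _ _]/= maxaff_cons; last by case: s s0 {ih h}.
rewrite (_ : (fun m => _) = (fun m => Num.max (ev (f m i) (x_ m))
    (maxaff [seq f m j | j <- s] (x_ m)))).
  apply: cvg_maxr; first by apply: h; rewrite mem_head.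
  by apply: ih => // j js; apply: h; rewrite inE js orbT.
by apply/funext => m; rewrite [map _ _]/= maxaff_cons//; case: s s0 {ih h}.
Qed.

End Limits.

(** * Maxima whose slopes do not span *)

Section Degenerate.
Context {R : realType} {n : nat}.
Implicit Types (u v : 'cV[R]_n -> R) (P : 'M[R]_n) (d : 'I_n -> R).
Implicit Types (a b : aff R n) (s t : seq (aff R n)).
Context (mu : ('cV[R]_n -> R) -> R) (muP : invariant_valuation mu)
  (mu0 : mu (fun=> 0) = 0).

Lemma cvx_cst (c : R) : cvx (fun _ : 'cV[R]_n => c).
Proof. by move=> t x y _; rewrite -mulrDl addrC subrK mul1r. Qed.

Lemma mu_cst (c : R) : mu (fun=> c) = 0.
Proof.
have := iv_affine muP (Aff 0 c) (cvx_cst 0); rewrite mu0 mulr0 => <-.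
by congr mu; apply/funext => x; rewrite add0r ev_cst.
Qed.

(** The maximum of [n + 1] affine functions, one of which has been normalized to
    be zero; up to a factor [n!], [\det P] is the signed volume of the simplex
    spanned by the slopes. *)
Definition simplex P d : 'cV[R]_n -> R :=
  maxaff (0 :: [seq Aff (row i P) (d i) | i <- enum 'I_n]).

Lemma simplex_mulmx P d (phi : 'M[R]_n) x :
  simplex P d (phi *m x) = simplex (P *m phi) d x.
Proof.
have evE i : ev (Aff (row i P) (d i)) (phi *m x) = ev (Aff (row i (P *m phi)) (d i)) x.
  by rewrite /ev/= row_mul mulmxA.
apply/eqP; rewrite eq_le !maxaff_le//; apply/andP; split; apply/allP => a;
  rewrite inE => /predU1P[->|/mapP[i ie ->]].
- by rewrite (le_trans _ (maxaff_ge x (mem_head _ _)))// !ev0.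
- by rewrite evE; apply: maxaff_ge; rewrite inE map_f ?orbT.
- by rewrite (le_trans _ (maxaff_ge (phi *m x) (mem_head _ _)))// !ev0.
- by rewrite -evE; apply: maxaff_ge; rewrite inE map_f ?orbT.
Qed.

Lemma mu_simplex_SL P d (phi : 'M[R]_n) : \det phi = 1 ->
  mu (simplex (P *m phi) d) = mu (simplex P d).
Proof.
move=> phi1; rewrite -[RHS](iv_SL muP (u := simplex P d) (cvx_maxaff _) phi1).
by congr mu; apply/funext => x; rewrite simplex_mulmx.
Qed.

(** Gaussian elimination gives [P = L *m pid_mx r *m U] with [r < n] and [L], [U]
    invertible. Conjugating by [U] a diagonal matrix of determinant one
    whose first [n - 1] entries are [l] yields an element [phi] of SL(n) with
    [P *m phi = l *: P]. So [mu] does not change when [P] is multiplied by [l],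
    and for [l --> 0] the function tends to a constant. *)
Lemma mu_simplex_det0 P d : \det P = 0 -> mu (simplex P d) = 0.
Proof.
move=> P0; have n0 := det0_dim P0.
set r := \rank P.
have rn : (r <= n.-1)%N.
  rewrite -ltnS prednK// ltn_neqAle rank_leq_row andbT.
  apply: contraTneq isT => rn; move/eqP: P0.
  by rewrite -[_ == _]negbK -unitfE -unitmxE -row_full_unit /row_full -/r rn eqxx.
have ln : (n.-1 < n)%N by rewrite prednK.
pose D (l : R) : 'M[R]_n :=
  diag_mx (\row_j if j == Ordinal ln then l ^- n.-1 else l).
have detD l : l != 0 -> \det (D l) = 1.
  move=> l0; rewrite det_diag (bigD1 (Ordinal ln))//= mxE eqxx.
  rewrite (eq_bigr (fun=> l)); last by move=> i /negbTE il; rewrite mxE il.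
  by rewrite prodr_const cardC1 card_ord mulVf// expf_neq0.
have uR := row_ebase_unit P.
pose phi l := invmx (row_ebase P) *m D l *m row_ebase P.
have detphi l : l != 0 -> \det (phi l) = 1.
  move=> l0; rewrite !det_mulmx detD// mulr1 mulrC -det_mulmx mulmxV//.
  by rewrite det1.
have Pphi l : P *m phi l = l *: P.
  rewrite /phi -{1}(mulmx_ebase P) !mulmxA mulmxK// -/r.
  rewrite -[X in _ = _ *: X](mulmx_ebase P) -/r scalemxAl; congr (_ *m _).
  rewrite -mulmxA scalemxAr; congr (_ *m _).
  apply/matrixP => i j; rewrite mul_mx_diag !mxE.
  case: eqVneq => [ij|_]; last by rewrite /= ?andbF mulr0 mul0r.
  case: ltnP => [ir|_]; last by rewrite /= ?andbF mulr0 mul0r.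
  rewrite ifN ?mul1r ?mulr1//; apply/eqP => jl; move: ij ir; rewrite jl /= => -> .
  by rewrite ltnNge rn.
have h l : l != 0 -> mu (simplex P d) = mu (simplex (l *: P) d).
  by move=> l0; rewrite -Pphi mu_simplex_SL// detphi.
have cv : (fun m => mu (simplex (m.+1%:R^-1 *: P) d)) @ \oo --> mu (simplex 0 d).
  apply: (iv_cts muP); [by move=> m; exact: cvx_maxaff | exact: cvx_maxaff|].
  move=> x_ x xx.
  have E Q : 0 :: [seq Aff (row i Q) (d i) | i <- enum 'I_n] =
      [seq if i is Some j then Aff (row j Q) (d j) else 0 |
        i <- None :: map some (enum 'I_n)] by rewrite /= -map_comp.
  rewrite /simplex E; under eq_fun do rewrite E.
  apply: cvg_maxaff => //; case => [i|] _; last first.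
    by rewrite ev0; under eq_fun do rewrite ev0; exact: cvg_cst.
  rewrite /ev/= row0 mul0mx mxE; apply: cvgD; last exact: cvg_cst.
  under eq_fun do rewrite linearZ/= -scalemxAl mxE.
  have := cvgM (@cvg_harmonic R) (cvg_mulrv (p := row i P) xx).
  by rewrite mul0r; apply.
have : (fun m : nat => mu (simplex (m.+1%:R^-1 *: P) d)) @ \oo --> mu (simplex P d).
  under eq_fun do rewrite -h ?invr_eq0 ?pnatr_eq0//.
  exact: cvg_cst.
move=> /(cvg_unique (@norm_hausdorff _ _) cv) <-.
rewrite (_ : simplex 0 d = fun=> simplex 0 d 0) ?mu_cst//.
by apply/funext => x; rewrite -{1}(mul0mx _ (0 : 'M[R]_n)) -simplex_mulmx mul0mx.
Qed.

(** The matrix and the heights of a list of at most [n] affine functions. The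
    default [0] is harmless: it is already one of the functions in [simplex]. *)
Definition mx_of t : 'M[R]_n := \matrix_(i, j) slope (nth 0 t i) 0 j.
Definition vec_of t (i : 'I_n) : R := height (nth 0 t i).

Lemma maxaff_simplex t : (size t <= n)%N ->
  maxaff (0 :: t) = simplex (mx_of t) (vec_of t).
Proof.
move=> tn; apply: eq_maxaff => a; rewrite !inE.
have E (i : 'I_n) : Aff (row i (mx_of t)) (vec_of t i) = nth 0 t i.
  rewrite [RHS](_ : _ = Aff (slope (nth 0 t i)) (height (nth 0 t i))); last by case: nth.
  congr Aff.
  by apply/rowP => j; rewrite !mxE.
have [//|a0/=] := eqVneq a 0; apply/idP/mapP => [at_|[i _ ai]].
  have ia : (index a t < n)%N by apply: leq_trans tn; rewrite index_mem.
  by exists (Ordinal ia); rewrite ?mem_enum// E nth_index.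
case: (ltnP i (size t)) => [it|ti]; first by rewrite ai E mem_nth.
by move: a0; rewrite ai E nth_default ?eqxx.
Qed.

(** Subtracting one of the affine functions from all of them reduces a maximum to
    one that contains zero. *)
Lemma maxaff_base a s :
  mu (maxaff (a :: s)) = expR (- height a) * mu (maxaff (0 :: [seq b - a | b <- s])).
Proof.
rewrite -(iv_affine muP a (cvx_maxaff _)); congr mu; apply/funext => x.
rewrite -maxaff_addr//=; congr maxaff; rewrite add0r; congr cons.
by rewrite -map_comp -[LHS]map_id; apply: eq_map => b /=; rewrite subrK.
Qed.

(** The matrix of slope differences has fewer than [n] nonzero rows. *)
Lemma mu_maxaff_small s : (size s <= n)%N -> mu (maxaff s) = 0.
Proof.
case: s => [_|a s ns].
  by rewrite (_ : maxaff _ = fun=> 0) ?mu0//; apply/funext => x;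
    rewrite /maxaff big_nil ev0.
rewrite maxaff_base maxaff_simplex ?size_map; last exact: ltnW.
rewrite mu_simplex_det0 ?mulr0//.
have n0 : (n.-1 < n)%N by rewrite prednK// (leq_trans _ ns).
rewrite (expand_det_row _ (Ordinal n0)) big1// => j _.
rewrite mxE nth_default/= ?mxE ?mul0r// size_map -ltnS prednK//.
exact: leq_trans ns.
Qed.

End Degenerate.

(** * Simplices with two equal heights *)

Section Coincidence.
Context {R : realType} {n : nat}.
Implicit Types (u v : 'cV[R]_n -> R) (P Q : 'M[R]_n) (d : 'I_n -> R).
Implicit Types (a b : aff R n) (s t : seq (aff R n)).
Context (mu : ('cV[R]_n -> R) -> R) (muP : invariant_valuation mu)
  (mu0 : mu (fun=> 0) = 0).

Lemma mu_simplex_det P Q d : \det P = \det Q ->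
  mu (simplex P d) = mu (simplex Q d).
Proof.
move=> PQ; have [P0|P0] := eqVneq (\det P) 0.
  by rewrite !(mu_simplex_det0 muP mu0)// -PQ.
have uP : P \in unitmx by rewrite unitmxE unitfE.
rewrite -(mu_simplex_SL muP P d (phi := invmx P *m Q)) ?mulKVmx//.
by rewrite det_mulmx det_inv -PQ mulVf.
Qed.

(** Cut the edge joining the vertices [i] and [j] at its midpoint: the heights are
    unchanged because they agree at both ends, each piece has half the
    determinant, and the cut itself is degenerate. *)
Lemma mu_simplex_halve P d i j : i != j -> d i = d j ->
  exists2 Q, \det Q = \det P / 2 & mu (simplex P d) = 2 * mu (simplex Q d).
Proof.
move=> ij dij.
pose rest := 0 :: [seq Aff (row k P) (d k) |
  k <- enum (predC (pred2 i j))].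
have H Q : (forall k, k != i -> k != j -> row k Q = row k P) ->
    simplex Q d = maxaff [:: (Aff (row i Q) (d i)), (Aff (row j Q) (d j)) & rest].
  move=> QP; apply: eq_maxaff => a; rewrite !inE.
  have [//|a0/=] := eqVneq a 0; first by rewrite !orbT.
  apply/mapP/or3P => [[k _ ->]|].
    have [->|ki] := eqVneq k i; first by constructor 1.
    have [->|kj] := eqVneq k j; first by constructor 2.
    constructor 3; apply/mapP; exists k; last by rewrite QP.
    by rewrite mem_enum !inE negb_or ki kj.
  case=> [/eqP ->|/eqP ->|/mapP[k]]; [by exists i; rewrite ?mem_enum|
    by exists j; rewrite ?mem_enum|].
  rewrite mem_enum !inE negb_or => /andP[ki kj] ->.
  by exists k; rewrite ?mem_enum// QP.
pose half : R := 2^-1.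
pose mid : 'rV[R]_n := half *: row i P + half *: row j P.
pose upd k0 w : 'M[R]_n := \matrix_k (if k == k0 then w else row k P).
have updE k0 w k : row k (upd k0 w) = if k == k0 then w else row k P.
  by rewrite rowK.
have row'_upd k0 w : row' k0 (upd k0 w) = row' k0 P.
  apply/row_matrixP => k; apply/rowP => l; rewrite !mxE.
  by rewrite eq_sym (negbTE (neq_lift _ _)) mxE.
have det_upd k0 k1 : k0 != k1 -> mid = half *: row k0 P + half *: row k1 P ->
    \det (upd k0 mid) = \det P / 2.
  move=> k01 midE.
  rewrite (@determinant_multilinear _ _ _ P (upd k0 (row k1 P)) k0 half half).
  - rewrite [X in _ + _ * X](determinant_alternate k01) ?mulr0 ?addr0 1?mulrC//.
    by move=> l; have /rowP/(_ l) := updE k0 (row k1 P) k0;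
      have /rowP/(_ l) := updE k0 (row k1 P) k1; rewrite eqxx eq_sym (negbTE k01);
      rewrite !mxE eqxx => <- ->.
  - by rewrite !updE !eqxx midE.
  - by rewrite row'_upd.
  - by rewrite !row'_upd.
have t01 : 0 <= half <= 1 by rewrite /half; lra.
exists (upd i mid); first exact: (det_upd i j).
have /= := mu_split muP (Aff (row i P) (d i)) (Aff (row j P) (d j)) (s := rest) t01 isT.
have -> : half *: Aff (row i P) (d i) + (1 - half) *: Aff (row j P) (d j) =
    Aff mid (d i).
  rewrite (_ : 1 - half = half); last by rewrite /half; lra.
  congr Aff; rewrite /= dij -scalerDl (_ : half + half = 1) ?scale1r//.
  by rewrite /half; lra.
rewrite (mu_maxaff_small muP mu0 (s := (Aff mid (d i)) :: rest)) ?addr0; last first.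
  rewrite /rest /= size_map -cardE.
  by have := cardC (pred2 i j); rewrite card2 ij card_ord /= => nE; rewrite -[leqRHS]nE.
rewrite -(H P)// => ->.
have -> : maxaff [:: Aff mid (d i), Aff (row j P) (d j) & rest] =
    simplex (upd i mid) d.
  rewrite H => [|k ki kj]; last by rewrite updE (negbTE ki).
  by rewrite !updE eqxx eq_sym (negbTE ij).
have -> : maxaff [:: Aff (row i P) (d i), Aff mid (d i) & rest] =
    simplex (upd j mid) d.
  rewrite H => [|k ki kj]; last by rewrite updE (negbTE kj).
  by rewrite !updE eqxx (negbTE ij) dij.
rewrite mulrDl mul1r; congr +%R; apply: mu_simplex_det.
by rewrite (det_upd i j)// (det_upd j i)// 1?eq_sym// addrC.
Qed.

Lemma mu_simplex_halve_iter N P Q d i j : i != j -> d i = d j ->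
  \det Q * 2 ^+ N = \det P -> mu (simplex P d) = 2 ^+ N * mu (simplex Q d).
Proof.
move=> ij dij; elim: N P => [|N ih] P QP.
  by rewrite expr0 mul1r; apply: mu_simplex_det; rewrite -QP expr0 mulr1.
have [P' P'E ->] := mu_simplex_halve P ij dij.
rewrite (ih P'); first by rewrite exprS mulrA.
by rewrite P'E -QP exprS; field.
Qed.

(** Both [row i P + l * d i] and its multiple by [l^-1] have this form. As [l] grows,
    the slope converges and the height grows at the rate [height e.2]. *)
Definition scaled_aff (l : R) (e : aff R n * aff R n) : aff R n :=
  Aff (slope e.1 + l^-1 *: slope e.2) (height e.1 + l * height e.2).

Lemma cvg_pow2V : (fun m : nat => (2 ^+ m : R)^-1) @ \oo --> 0.
Proof.
have h := @cvg_expr R (2^-1) _.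
have -> : (fun m : nat => (2 ^+ m : R)^-1) = (fun m : nat => 2^-1 ^+ m).
  by apply/funext => m; rewrite exprVn.
by apply: h; rewrite ger0_norm; lra.
Qed.

(** Let [M] be the largest of the numbers [height e.2]. After subtraction of the
    constant [2 ^+ m * M] the maximum converges: the functions of growth rate [M]
    have a limit, and the others disappear towards minus infinity. Hence the
    values of [mu] on the normalized functions are bounded, and the
    subtracted constant accounts for the exponential factor. *)
Lemma mu_scaled_bound (s : seq (aff R n * aff R n)) e (B : R) :
  e \in s -> B <= height e.2 -> exists C, forall m,
  `|mu (maxaff [seq scaled_aff (2 ^+ m) e | e <- s])| <= C * expR (- (2 ^+ m * B)).
Proof.
move=> es eB; have s0 : s != [::] by case: s es.
have [e0 e0s e0max] := seq_argmax (fun e => height e.2) s0.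
pose M := height e0.2; pose l m : R := 2 ^+ m.
have l_gt0 m : 0 < l m by rewrite exprn_gt0.
pose S := [seq e <- s | height e.2 == M].
have S0 : S != [::].
  apply/eqP => S0; have := mem_filter (fun e => height e.2 == M) e0 s.
  by rewrite -/S S0 e0s eqxx.
pose w m x := maxaff [seq scaled_aff (l m) e | e <- s] x + ev (Aff 0 (- (l m * M))) x.
have wE m : mu (w m) = expR (l m * M) * mu (maxaff [seq scaled_aff (l m) e | e <- s]).
  by rewrite /w (iv_affine muP (Aff 0 (- (l m * M))) (cvx_maxaff _)) /= opprK.
have wcvg : (fun m => mu (w m)) @ \oo --> mu (maxaff [seq e.1 | e <- S]).
  apply: (iv_cts muP) => [m||x_ x xx].
  - by apply: cvx_add; [exact: cvx_maxaff|exact: cvx_ev].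
  - exact: cvx_maxaff.
  pose a m (e : aff R n * aff R n) := e.1 + (l m)^-1 *: Aff (slope e.2) 0.
  have acvg f : (fun m => ev (a m f) (x_ m)) @ \oo --> ev f.1 x.
    rewrite -[X in _ --> X]addr0 -(mul0r ((slope f.2 *m x) 0 0)).
    rewrite (_ : (fun m => _) = (fun m => ev f.1 (x_ m) +
        (l m)^-1 * (slope f.2 *m x_ m) 0 0)).
      apply: cvgD.
        by apply: cvgD; [exact: cvg_mulrv|exact: cvg_cst].
      by apply: cvgM; [exact: cvg_pow2V|exact: cvg_mulrv].
    by apply/funext => m; rewrite /a evD evZ /ev/= addr0.
  have scE m f : ev (scaled_aff (l m) f) (x_ m) =
      ev (a m f) (x_ m) + l m * height f.2.
    rewrite -(ev_cst (l m * height f.2) (x_ m)) -evD; congr ev.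
    by congr Aff; rewrite /= ?mulr0 ?addr0.
  (* functions whose height grows more slowly than M are eventually dominated *)
  have dom : \forall m \near \oo, forall f, f \in s -> height f.2 < M ->
      ev (scaled_aff (l m) f) (x_ m) <= ev (scaled_aff (l m) e0) (x_ m).
    elim: (s) => [|f t ih]; first by near=> m.
    have {}ih : \forall m \near \oo, forall f, f \in t -> height f.2 < M ->
      ev (scaled_aff (l m) f) (x_ m) <= ev (scaled_aff (l m) e0) (x_ m) by [].
    have hf : height f.2 < M -> \forall m \near \oo,
        ev (scaled_aff (l m) f) (x_ m) <= ev (scaled_aff (l m) e0) (x_ m).
      move=> fM.
      have : (fun m => (ev (a m f) (x_ m) - ev (a m e0) (x_ m)) * (l m)^-1)
          @ \oo --> (ev f.1 x - ev e0.1 x) * 0.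
        by apply: cvgM; [exact: cvgB|exact: cvg_pow2V].
      rewrite mulr0 => /cvgr_lt /(_ (M - height f.2)).
      rewrite subr_gt0 => /(_ fM); apply: filterS => m.
      rewrite ltr_pdivrMr// !scE -/M => /ltW; lra.
    have [fM|fM] := ltP (height f.2) M.
      have {}hf := hf fM; near=> m => g; rewrite inE => /predU1P[->|].
        by move=> _; near: m.
      by move: g; near: m.
    apply: filterS ih => m hm g; rewrite inE => /predU1P[->|]; last exact: hm.
    by rewrite ltNge fM.
  have : (fun m => maxaff [seq a m e | e <- S] (x_ m)) @ \oo -->
      maxaff [seq e.1 | e <- S] x by apply: cvg_maxaff.
  apply: cvg_trans; apply: near_eq_cvg; near=> m.
  rewrite /w ev_cst; apply/eqP; rewrite eq_le; apply/andP; split.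
    rewrite maxaff_le; last by case: (S) S0.
    apply/allP => _ /mapP[f + ->]; rewrite mem_filter => /andP[/eqP fM fs].
    by rewrite lerBrDr -fM -scE maxaff_ge// map_f.
  rewrite lerBlDr maxaff_le; last by case: (s) s0.
  have e0S : ev (scaled_aff (l m) e0) (x_ m) <=
      maxaff [seq a m e | e <- S] (x_ m) + l m * M.
    by rewrite scE lerD2r maxaff_ge// map_f// mem_filter eqxx.
  apply/allP => _ /mapP[f fs ->].
  have [fM|fM] := eqVneq (height f.2) M.
    by rewrite scE fM lerD2r maxaff_ge// map_f// mem_filter fM eqxx.
  apply: le_trans e0S.
  have {}fM : height f.2 < M by rewrite lt_neqAle fM e0max.
  by move: f fs fM; near: m.
have [C Cbnd] : exists C, forall m, `|mu (w m)| <= C.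
  have [C [Creal Cb]] := cvg_seq_bounded (cvgP _ wcvg).
  by exists (`|C| + 1) => m; apply: Cb => //; rewrite ltr_pwDr// ler_norm.
exists C => m; rewrite -/(l m).
have -> : mu (maxaff [seq scaled_aff (l m) e | e <- s]) =
    expR (- (l m * M)) * mu (w m).
  by rewrite wE mulrA -expRD addNr expR0 mul1r.
rewrite normrM (ger0_norm (expR_ge0 _)) [leLHS]mulrC.
apply: ler_pM; [exact: normr_ge0|exact: expR_ge0|exact: Cbnd|].
rewrite ler_expR lerN2 ler_pM2l//; apply: le_trans eB _; exact: e0max.
Unshelve. all: by end_near.
Qed.

(** With [l = 2 ^+ m], go from the big simplex with functions [0] and
    [row i P + l * d i] to the small one with functions [0] and
    [l^-1 *: row i P + d i] by shrinking one edge at the vertex [0] at a time: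
    [D m k] is the stage where the first [k] edges are shrunk. Each step
    cuts off a piece [res] that no longer contains the vertex [0], so that all
    pieces, like the big simplex, have a height growing at least like [l * B],
    and [mu_scaled_bound] applies to them. *)
Lemma mu_small_simplex_bound P d (B : R) : (1 < n)%N -> (forall i, B <= d i) ->
  exists C, forall m,
  `|mu (simplex ((2 ^+ m)^-1 *: P) d)| <= C * expR (- (2 ^+ m * B)).
Proof.
move=> n1 Bd; pose l m : R := 2 ^+ m.
have l_ge1 m : 1 <= l m by rewrite exprn_ege1// ler1n.
pose F m k (i : 'I_n) : aff R n :=
  if (i < k)%N then Aff ((l m)^-1 *: row i P) (d i) else Aff (row i P) (l m * d i).
pose G k (i : 'I_n) : aff R n * aff R n :=
  if (i < k)%N then (Aff 0 (d i), Aff (row i P) 0) else (Aff (row i P) 0, Aff 0 (d i)).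
have GF m k i : scaled_aff (l m) (G k i) = F m k i.
  rewrite /scaled_aff /G /F; case: ifP => _ /=.
    by rewrite add0r mulr0 addr0.
  by rewrite scaler0 addr0 add0r.
pose D m k := maxaff (0 :: [seq F m k i | i <- enum 'I_n]).
suff : forall k, (k <= n)%N -> exists C, forall m,
    `|mu (D m k)| <= C * expR (- (l m * B)).
  move=> /(_ n (leqnn n))[C hC]; exists C => m; apply: le_trans (hC m).
  rewrite le_eqVlt; apply/orP; left; apply/eqP; congr (`|mu (maxaff (_ :: _))|).
  by apply: eq_map => i; rewrite /F ltn_ord linearZ.
elim=> [_|k ih kn].
  have e0 : (Aff (row (Ordinal (ltnW n1)) P) 0, Aff 0 (d (Ordinal (ltnW n1)))) \in
      0 :: [seq G 0%N i | i <- enum 'I_n].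
    by rewrite inE; apply/orP; right; apply/mapP; exists (Ordinal (ltnW n1));
      rewrite ?mem_enum.
  have [C hC] := mu_scaled_bound e0 (Bd _); exists C => m.
  apply: le_trans (hC m); rewrite le_eqVlt; apply/orP; left; apply/eqP.
  congr (`|mu (maxaff _)|) => /=; congr cons.
    by rewrite /scaled_aff/= scaler0 mulr0 !addr0.
  by rewrite -map_comp; apply: eq_map => i /=; rewrite GF.
have [C1 h1] := ih (ltnW kn).
pose i0 := Ordinal kn; pose others := enum (predC1 i0).
have i0_others (f : 'I_n -> aff R n) :
    f i0 :: [seq f i | i <- others] =i [seq f i | i <- enum 'I_n].
  move=> a; rewrite inE; apply/idP/mapP => [/predU1P[->|/mapP[i _ ->]]|[i _ ->]].
  - by exists i0; rewrite ?mem_enum.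
  - by exists i; rewrite ?mem_enum.
  have [->|ii0] := eqVneq i i0; first by rewrite eqxx.
  by apply/orP; right; apply: map_f; rewrite mem_enum !inE.
have size_others : size others = n.-1 by rewrite -cardE cardC1 card_ord.
have Fothers m : [seq F m k.+1 i | i <- others] = [seq F m k i | i <- others].
  apply/eq_in_map => i; rewrite mem_enum !inE => ii0.
  by rewrite /F ltnS leq_eqVlt -[i == k :> nat]/(i == i0) (negbTE ii0).
pose res := [:: (Aff (row i0 P) 0, Aff 0 (d i0)), (Aff 0 (d i0), Aff (row i0 P) 0) &
  [seq G k i | i <- others]] : seq (aff R n * aff R n).
have [C2 h2] := mu_scaled_bound (mem_head _ _ : _ \in res) (Bd i0).
exists (C1 + C2) => m; rewrite mulrDl.
have -> : mu (D m k.+1) = mu (D m k) - mu (maxaff [seq scaled_aff (l m) e | e <- res]).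
  have l01 : 0 <= (l m)^-1 <= 1.
    by rewrite invr_ge0 (le_trans ler01)//= invf_le1// (lt_le_trans ltr01).
  have := mu_split muP (F m k i0) 0 (s := [seq F m k i | i <- others]) l01.
  have -> : (l m)^-1 *: F m k i0 + (1 - (l m)^-1) *: 0 = F m k.+1 i0.
    rewrite scaler0 addr0 /F/= ltnn ltnSn; congr Aff => /=.
    by rewrite /GRing.scale/= mulKf// gt_eqF// (lt_le_trans ltr01).
  have rest0 : [seq F m k i | i <- others] != [::].
    by rewrite -size_eq0 size_map size_others -lt0n -ltnS prednK// ltnW.
  move=> /(_ rest0).
  rewrite (mu_maxaff_small muP mu0 (s := F m k.+1 i0 :: _)); last first.
    by rewrite /= size_map size_others prednK// ltnW.
  have DE k' : D m k' = maxaff [:: F m k' i0, 0 & [seq F m k' i | i <- others]].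
    apply: eq_maxaff => a; rewrite [in RHS]inE orbCA.
    rewrite -[_ || (_ \in _ :: _)]/(a \in 0 :: F m k' i0 :: _).
    by rewrite !inE -i0_others !inE.
  have -> : [seq scaled_aff (l m) e | e <- res] =
      [:: F m k i0, F m k.+1 i0 & [seq F m k i | i <- others]].
    rewrite /res /= -map_comp; congr [:: _, _ & _].
    - by rewrite -GF /G ltnn.
    - by rewrite -GF /G ltnSn.
    by apply: eq_map => i /=; rewrite GF.
  by rewrite addr0 !DE Fothers => ->; rewrite addrK.
apply: le_trans (ler_normB _ _) _; exact: lerD.
Qed.

(** Halving [m * n] times gives
    [mu (simplex P d) = l ^+ n * mu (simplex (l^-1 *: P) d)] for [l = 2 ^+ m], where
    the right-hand side tends to zero by [mu_small_simplex_bound]. The explicit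
    estimate is [expR (l * B) >= (l * B / (n + 1)) ^+ (n + 1)]. *)
Lemma mu_simplex_coincidence_gt0 P d i j : i != j -> d i = d j ->
  (forall k, 0 < d k) -> mu (simplex P d) = 0.
Proof.
move=> ij dij d0.
have n1 : (1 < n)%N.
  by have := max_card (pred2 i j); rewrite card2 ij card_ord.
have [i0 _ i0min] := seq_argmax (fun k => - d k) (s := i :: enum 'I_n) isT.
pose B := d i0; have B0 : 0 < B := d0 i0; have Bd k : B <= d k.
  by rewrite -lerN2 i0min// inE mem_enum orbT.
have [C hC] := mu_small_simplex_bound P n1 Bd.
have C0 : 0 <= C.
  by have := le_trans (normr_ge0 _) (hC 0%N); rewrite pmulr_lge0 ?expR_gt0.
have key m : `|mu (simplex P d)| * 2 ^+ m <= C * (n.+1%:R / B) ^+ n.+1.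
  have detE : \det ((2 ^+ m)^-1 *: P) * 2 ^+ (m * n) = \det P.
    by rewrite detZ mulrAC exprVn exprM mulVf ?mul1r// expf_neq0// expf_neq0.
  rewrite (mu_simplex_halve_iter ij dij detE) normrM ger0_norm ?exprn_ge0//.
  rewrite mulrAC exprM -exprSr mulrC; set l := 2 ^+ m.
  have l0 : 0 < l by rewrite exprn_gt0.
  have lB : l ^+ n.+1 * expR (- (l * B)) <= (n.+1%:R / B) ^+ n.+1.
    have -> : l * B = (l * B / n.+1%:R) * n.+1%:R by rewrite mulfVK ?pnatr_eq0.
    rewrite expRN expRM_natr ler_pdivrMr ?exprn_gt0 ?expR_gt0// -exprMn.
    apply: lerXn2r; rewrite ?nnegrE.
    - exact: ltW.
    - by rewrite mulr_ge0 ?expR_ge0// divr_ge0// ltW.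
    have h := expR_ge1Dx (l * B / n.+1%:R).
    apply: le_trans (_ : n.+1%:R / B * (l * B / n.+1%:R) <= _).
      by rewrite -[l * B]mulrC !mulrA divfK ?gt_eqF// mulrC mulKf ?pnatr_eq0.
    rewrite ler_pM2l ?divr_gt0// ?ltr0n//; by apply: le_trans h; rewrite lerDr.
  apply: le_trans (ler_wpM2r _ (hC m)) _; first by rewrite exprn_ge0// ltW.
  by rewrite -mulrA [_ * _ ^+ _]mulrC ler_wpM2l.
apply/eqP; rewrite -normr_eq0; apply/eqP; apply: contrapT => /eqP mu_neq0.
set K := C * _ in key.
have mu_gt0 : 0 < `|mu (simplex P d)| by rewrite lt_neqAle eq_sym mu_neq0 normr_ge0.
have := archi_boundP (_ : 0 <= K / `|mu (simplex P d)|).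
set N := Num.bound _ => /(_ _)/wrap[].
  by rewrite divr_ge0// mulr_ge0// exprn_ge0// divr_ge0// ltW.
rewrite ltr_pdivrMr// => KN; have := lt_le_trans KN.
move=> /(_ (`|mu (simplex P d)| * 2 ^+ N)); rewrite mulrC ler_pM2l//.
rewrite -natrX ler_nat => /(_ (ltnW (ltn_expl _ _)))/wrap[//|].
by rewrite natrX ltNge key.
Qed.

(** Raising all heights [d i] by the same amount preserves the coincidence. *)
Lemma mu_simplex_coincidence P d i j : i != j -> d i = d j ->
  (forall k, 0 <= d k) -> mu (simplex P d) = 0.
Proof.
move=> ij dij d0.
have cv : (fun m => mu (simplex P (fun k => d k + m.+1%:R^-1))) @ \oo -->
    mu (simplex P d).
  apply: (iv_cts muP); [by move=> m; exact: cvx_maxaff | exact: cvx_maxaff|].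
  move=> x_ x xx.
  pose f (e : R) (k : option 'I_n) : aff R n :=
    if k is Some k then Aff (row k P) (d k + e) else 0.
  have E e : simplex P (fun k => d k + e) =
      maxaff [seq f e k | k <- None :: map some (enum 'I_n)].
    by rewrite /= -map_comp.
  have -> : simplex P d = maxaff [seq f 0 k | k <- None :: map some (enum 'I_n)].
    by rewrite -E; congr simplex; apply/funext => k; rewrite addr0.
  under eq_fun do rewrite E.
  apply: cvg_maxaff => //; case => [k|] _ /=.
    apply: cvgD; first exact: cvg_mulrv.
    by apply: cvgD; [exact: cvg_cst | exact: cvg_harmonic].
  by rewrite ev0; under eq_fun do rewrite ev0; exact: cvg_cst.
apply: (cvg_unique (@norm_hausdorff _ _) cv).
rewrite (_ : (fun m => _) = fun=> 0); first exact: cvg_cst.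
apply/funext => m; apply: (mu_simplex_coincidence_gt0 _ ij); first by rewrite dij.
by move=> k; rewrite ltr_wpDl// invr_gt0.
Qed.

End Coincidence.

(** * Arbitrary maxima of affine functions *)

Section SeqReordering.
Context {T : eqType}.
Implicit Types (x y z w : T) (r s t : seq T).

Lemma mem_permute3 x y z r : [/\ [:: x, z, y & r] =i [:: x, y, z & r],
  [:: y, x, z & r] =i [:: x, y, z & r], [:: y, z, x & r] =i [:: x, y, z & r],
  [:: z, x, y & r] =i [:: x, y, z & r] & [:: z, y, x & r] =i [:: x, y, z & r]].
Proof.
by split=> e; rewrite !in_cons; case: (e == x); case: (e == y); case: (e == z).
Qed.

Lemma mem_cycle4 x y z w r : [:: x, y, z, w & r] =i [:: z, x, w, y & r].
Proof.
move=> e; rewrite !in_cons.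
by case: (e == x); case: (e == y); case: (e == z); case: (e == w).
Qed.

Lemma eq_mem_cons x r s : r =i s -> x :: r =i x :: s.
Proof. by move=> rs e; rewrite !in_cons rs. Qed.

Lemma mem_cons_cat x y r s : [:: x, y & r ++ s] =i (y :: r) ++ (x :: s).
Proof.
move=> e; rewrite !(in_cons, mem_cat).
by case: (e == x); case: (e == y); rewrite ?orbT.
Qed.

Lemma mem_swap x y r : [:: x, y & r] =i [:: y, x & r].
Proof. by move=> e; rewrite !in_cons orbCA. Qed.

End SeqReordering.

Section PiecewiseAffine.
Context {R : realType} {n : nat}.
Implicit Types (a b c k q : aff R n) (s t r : seq (aff R n)).
Context (mu : ('cV[R]_n -> R) -> R) (muP : invariant_valuation mu)
  (mu0 : mu (fun=> 0) = 0).

Lemma mu_maxaff_coincidence k a b r : (size [:: k, a, b & r] <= n.+1)%N ->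
  height a = height b -> (forall c, c \in [:: a, b & r] -> height k <= height c) ->
  mu (maxaff [:: k, a, b & r]) = 0.
Proof.
move=> sn ab kmin; rewrite (maxaff_base muP); set t := map _ _.
have st : size t = size [:: a, b & r] by rewrite size_map.
rewrite maxaff_simplex ?st//.
have n1 : (1 < n)%N by rewrite -ltnS (leq_trans _ sn).
have n0 := ltnW n1.
rewrite (mu_simplex_coincidence muP mu0 _ (i := Ordinal n0) (j := Ordinal n1)) ?mulr0//.
  by rewrite /vec_of /= ab.
move=> i; rewrite /vec_of; case: (ltnP i (size t)) => [it|ti].
  rewrite (nth_map 0) -?st//= subr_ge0 kmin// mem_nth// -st//.
by rewrite nth_default.
Qed.

(** Let [q] be the point at height [height b] on the edge from [a] to [c]. Both
    pieces cut off at [q] contain [b] and [q], at equal heights, and the lowest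
    vertex [k]. *)
Lemma mu_maxaff_sorted k a b c r : size [:: k, a, b, c & r] = n.+1 ->
  height a <= height b <= height c ->
  (forall e, e \in [:: a, b, c & r] -> height k <= height e) ->
  mu (maxaff [:: k, a, b, c & r]) = 0.
Proof.
move=> sn /andP[ab bc] kmin.
have [ac|ac] := leP (height c) (height a).
  by apply: mu_maxaff_coincidence; rewrite ?sn//; apply/eqP;
    rewrite eq_le ab (le_trans bc ac).
pose t := (height c - height b) / (height c - height a).
have ca0 : 0 < height c - height a by rewrite subr_gt0.
have t01 : 0 <= t <= 1.
  rewrite /t divr_ge0 ?subr_ge0// ?(ltW ac)//= ler_pdivrMr// mul1r.
  by rewrite lerD2l lerN2.
have := mu_split muP a c (s := [:: k, b & r]) t01 isT.
set q := t *: a + (1 - t) *: c.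
have q2 : height q = height b.
  by rewrite /q/= /t; field; exact: lt0r_neq0.
clearbody q.
have coinc x : x \in [:: a; c] -> mu (maxaff [:: k, q, b, x & r]) = 0.
  move=> xac; apply: mu_maxaff_coincidence; [by rewrite -sn|by []|].
  move=> e; rewrite !in_cons => /or4P[/eqP ->|/eqP ->|/eqP ->|er].
  - by rewrite q2 kmin// !in_cons eqxx orbT.
  - by rewrite kmin// !in_cons eqxx orbT.
  - by move: xac; rewrite !in_cons in_nil orbF => /orP[]/eqP ->;
      rewrite kmin// !in_cons eqxx ?orbT.
  - by rewrite kmin// !in_cons er !orbT.
rewrite [X in _ + X](mu_maxaff_small muP mu0); last first.
  by rewrite -ltnS -sn.
rewrite addr0 => E.
rewrite -(eq_maxaff (mem_cycle4 a c k b r)) E (eq_maxaff (mem_cycle4 q c k b r)).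
rewrite coinc ?in_cons ?eqxx ?orbT// add0r (eq_maxaff (mem_cycle4 a q k b r)).
have [_ _ _ _ /(eq_mem_cons k)/eq_maxaff ->] := mem_permute3 q b a r.
by rewrite coinc ?in_cons ?eqxx.
Qed.

Lemma mu_maxaff_succ s : (2 < n)%N -> size s = n.+1 -> mu (maxaff s) = 0.
Proof.
move=> n3 sn.
have s0 : s != [::] by case: s sn.
have [k ks kmax] := seq_argmax (fun a => - height a) s0.
have ps := perm_to_rem ks.
rewrite (eq_maxaff (perm_mem ps)).
have sr : size (rem k s) = n by apply/succn_inj; rewrite -sn (perm_size ps).
have kmin e : e \in rem k s -> height k <= height e.
  by move=> /mem_rem/kmax; rewrite lerN2.
move: (rem k s) sr kmin => [|a [|b [|c r]]] /= sr kmin; try by rewrite -sr in n3.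
have H x y z : height x <= height y <= height z -> [:: x, y, z & r] =i [:: a, b, c & r] ->
    mu (maxaff [:: k, a, b, c & r]) = 0.
  move=> xyz E; rewrite (@eq_maxaff _ _ _ [:: k, x, y, z & r]).
    apply: mu_maxaff_sorted; [exact: (congr1 succn sr) | exact: xyz |].
    by move=> e; rewrite E; exact: kmin.
  exact/eq_mem_cons/fsym.
have [Eacb Ebac Ebca Ecab Ecba] := mem_permute3 a b c r.
have [ab|/ltW ab] := leP (height a) (height b);
  have [bc|/ltW bc] := leP (height b) (height c);
  have [ac|/ltW ac] := leP (height a) (height c).
- by apply: (H a b c) (fun=> erefl _); rewrite ab.
- by apply: (H a b c) (fun=> erefl _); rewrite ab.
- by apply: H Eacb; rewrite ac bc.
- by apply: H Ecab; rewrite ac ab.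
- by apply: H Ebac; rewrite ab ac.
- by apply: H Ebca; rewrite bc ac.
- by apply: H Ecba; rewrite bc ab.
- by apply: H Ecba; rewrite bc ab.
Qed.

(** The relation says that the mean of the affine functions in [I] lies below the
    mean of those in [J]. If [I] is a singleton, its function is redundant.
    Otherwise cut the edge between two elements of [I] at their weighted
    mean [q]; in either piece [q] replaces both of them in the relation, and the
    endpoint that is kept joins [J] with weight zero. *)
Lemma mu_maxaff_relation (N : nat) (I J : seq (R * aff R n)) :
  (forall s, (size s < N)%N -> mu (maxaff s) = 0) ->
  I != [::] -> (size I + size J <= N)%N ->
  (forall p, p \in I -> 0 < p.1) -> (forall p, p \in J -> 0 <= p.1) ->
  \sum_(p <- I) p.1 = \sum_(p <- J) p.1 ->
  (forall x, \sum_(p <- I) p.1 * ev p.2 x <= \sum_(p <- J) p.1 * ev p.2 x) ->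
  mu (maxaff [seq p.2 | p <- I ++ J]) = 0.
Proof.
move=> ih; elim: {I}(size I) {-2}I J (leqnn (size I)) => [|m IHm] I J.
  by rewrite leqn0 size_eq0 => ->.
case: I => // -[l1 a1] [|[l2 a2] I] sI _ sIJ I0 J0 wIJ IJ.
  move: wIJ IJ; rewrite big_seq1/= => wIJ IJ.
  have l1_gt0 : 0 < l1 by apply: (I0 (l1, a1)); rewrite mem_head.
  have J1 : [seq p.2 | p <- J] != [::].
    by case: (J) wIJ => //; rewrite big_nil => l10; rewrite l10 ltxx in l1_gt0.
  rewrite -(ih [seq p.2 | p <- J]); last by rewrite size_map.
  congr mu; apply/funext => x; rewrite maxaff_cons//; apply/max_idPr.
  rewrite -(ler_pM2l l1_gt0); have := IJ x; rewrite big_seq1/= => /le_trans; apply.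
  rewrite wIJ mulr_suml big_seq [leRHS]big_seq; apply: ler_sum => p pJ.
  by apply: ler_wpM2l; [exact: J0 | exact/maxaff_ge/map_f].
have l1_gt0 : 0 < l1 by apply: (I0 (l1, a1)); rewrite mem_head.
have l2_gt0 : 0 < l2 by apply: (I0 (l2, a2)); rewrite !in_cons eqxx orbT.
pose l := l1 + l2; have l_gt0 : 0 < l by rewrite addr_gt0.
have t01 : 0 <= l1 / l <= 1.
  by rewrite divr_ge0 ?(ltW l_gt0) ?(ltW l1_gt0)//= ler_pdivrMr// mul1r lerDl ltW.
pose rest := [seq p.2 | p <- I ++ J].
have [rest0|rest0] := eqVneq rest [::].
  (* both lists would be empty, and the weights would force [l1 + l2 = 0] *)
  have := wIJ; have : (I == [::]) && (J == [::]).
    by rewrite -!size_eq0 -addn_eq0 -size_cat -(size_map snd) -/rest rest0.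
  move=> /andP[/eqP -> /eqP ->]; rewrite !big_cons !big_nil/= addr0 => l0.
  by rewrite /l l0 ltxx in l_gt0.
have := mu_split muP a1 a2 t01 rest0; set q := (l1 / l) *: a1 + (1 - l1 / l) *: a2.
have qE x : l * ev q x = l1 * ev a1 x + l2 * ev a2 x.
  by rewrite evD !evZ /l; field; exact: lt0r_neq0.
have side x : mu (maxaff [:: x, q & rest]) = 0.
  rewrite (@eq_maxaff _ _ _
    [seq p.2 | p <- ((l, q) :: I) ++ ((0, x) :: J)]); last first.
    by rewrite /rest !map_cat; exact: mem_cons_cat.
  apply: IHm => //.
  - by rewrite /= addnS -addSn; exact: leq_trans sIJ.
  - move=> p; rewrite in_cons => /predU1P[->//|pI].
    by apply: I0; rewrite !in_cons pI !orbT.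
  - by move=> p; rewrite in_cons => /predU1P[->//|]; exact: J0.
  - by rewrite !big_cons/= add0r -wIJ !big_cons/= addrA.
  - move=> y; rewrite !big_cons/= mul0r add0r qE -addrA.
    by have := IJ y; rewrite !big_cons.
have swap : maxaff [:: q, a2 & rest] = maxaff [:: a2, q & rest].
  exact/eq_maxaff/mem_swap.
rewrite swap !side addr0 (ih (q :: rest)) ?addr0//.
by rewrite /= size_map size_cat; exact: sIJ.
Qed.

(** More than [n + 1] vectors [(slope, 1)] in dimension [n + 1] are linearly
    dependent. The coefficients [v] of a dependence sum to zero and annihilate the
    slopes, so the same combination of the affine functions is constant;
    the sign of this constant decides which side of the relation is the
    lower one. *)
Lemma mu_maxaff0 : (2 < n)%N -> forall s, mu (maxaff s) = 0.
Proof.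
move=> n3 s; have [N] := ubnP (size s); elim: N s => // N ih s sN.
have [sn|sn] := leqP (size s) n; first exact: mu_maxaff_small.
have [sn1|sn1] := eqVneq (size s) n.+1; first exact: mu_maxaff_succ.
have {sn1}sn : (n + 1 < size s)%N by rewrite addn1 ltn_neqAle eq_sym sn1.
pose A : 'M[R]_(size s, n + 1) := \matrix_i row_mx (slope (nth 0 s i)) 1.
have [v v0 vA] : exists2 v : 'rV[R]_(size s), v != 0 & v *m A = 0.
  exists (nz_row (kermx A)); last by apply/sub_kermxP; exact: nz_row_sub.
  rewrite nz_row_eq0 kermx_eq0 /row_free; apply: contraTneq sn => rA.
  by rewrite -leqNgt -[leqLHS]rA rank_leq_col.
have rel (x : 'cV[R]_n) (w : 'rV[R]_(size s)) : w *m A = 0 ->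
    \sum_i w 0 i * ev (nth 0 s i) x = \sum_i w 0 i * height (nth 0 s i) /\
    \sum_i w 0 i = 0.
  move=> wA; have key (z : 'cV[R]_n) (e : R) :
      \sum_i w 0 i * ((slope (nth 0 s i) *m z) 0 0 + e) = 0.
    (* evaluate the dependence at the vector (z, e) *)
    transitivity ((w *m A *m col_mx z e%:M) 0 0); last by rewrite wA mul0mx mxE.
    rewrite -mulmxA mxE; apply: eq_bigr => i _; congr (_ * _).
    transitivity ((row i (A *m col_mx z e%:M)) 0 0); last by rewrite mxE.
    by rewrite row_mul rowK mul_row_col mul1mx [RHS]mxE [e%:M _ _]mxE eqxx.
  split.
    rewrite -[RHS]add0r -[X in X + _](key x 0) -big_split/=.
    by apply: eq_bigr => i _; rewrite addr0 -mulrDr.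
  by rewrite -[RHS](key 0 1); apply: eq_bigr => i _; rewrite mulmx0 mxE add0r mulr1.
wlog sgn : v v0 vA / \sum_i v 0 i * height (nth 0 s i) <= 0.
  move=> W; have [|/ltW h] := leP (\sum_i v 0 i * height (nth 0 s i)) 0; first exact: W.
  apply: (W (- v)); rewrite ?oppr_eq0// ?mulNmx ?vA ?oppr0//.
  under eq_bigr do rewrite mxE mulNr; by rewrite sumrN oppr_le0.
pose I := [seq (v 0 i, nth 0 s i) | i <- enum 'I_(size s) & 0 < v 0 i].
pose J := [seq (- v 0 i, nth 0 s i) | i <- enum 'I_(size s) & ~~ (0 < v 0 i)].
have sumE (F : 'I_(size s) -> R) :
    \sum_(i <- enum 'I_(size s) | 0 < v 0 i) F i
    - \sum_(i <- enum 'I_(size s) | ~~ (0 < v 0 i)) (- F i) = \sum_i F i.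
  by rewrite sumrN opprK -big_enum/= [RHS](bigID (fun i => 0 < v 0 i)).
have v1 := (rel 0 v vA).2.
rewrite (@eq_maxaff _ _ _ [seq p.2 | p <- I ++ J]); last first.
  move=> a; rewrite map_cat mem_cat -!map_comp.
  apply/(nthP 0)/orP => [[i is_ <-]|].
    pose i' := Ordinal is_.
    have [vi|vi] := boolP (0 < v 0 i'); [left|right];
      by apply/mapP; exists i'; rewrite // mem_filter vi mem_enum.
  by case=> /mapP[i _ ->]; exists i.
apply: (@mu_maxaff_relation (size s)).
- by move=> t ts; apply: ih; exact: leq_trans ts _.
- apply/negP => /eqP I0; move/eqP: v0; apply.
  have vle i : v 0 i <= 0.
    rewrite leNgt; apply/negP => vi.
    suff : (v 0 i, nth 0 s i) \in I by rewrite I0.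
    by apply: map_f; rewrite mem_filter vi mem_enum.
  apply/rowP => i; rewrite mxE; apply/eqP; rewrite -oppr_eq0; apply/eqP.
  have : \sum_i (- v 0 i) == 0 by rewrite sumrN v1 oppr0.
  rewrite psumr_eq0 => [|j _]; last by rewrite oppr_ge0.
  by move=> /allP/(_ i (mem_index_enum _))/eqP.
- rewrite /I /J !size_map -size_cat (perm_size (permEl (perm_filterC _ _))).
  by rewrite size_enum_ord.
- by move=> p /mapP[i]; rewrite mem_filter => /andP[? _] ->.
- by move=> p /mapP[i]; rewrite mem_filter -leNgt => /andP[? _] ->; rewrite oppr_ge0.
- by rewrite !big_map !big_filter/=; apply/eqP; rewrite -subr_eq0 sumE v1.
- move=> x; rewrite !big_map !big_filter/= -subr_le0.
  under [X in _ - X]eq_bigr do rewrite mulNr.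
  by rewrite sumE (rel x v vA).1.
Qed.

End PiecewiseAffine.

(** * Subgradients of finite convex functions *)

Section Subgradient.
Context {R : realType} {n : nat}.
Implicit Types (u v : 'cV[R]_n -> R) (g : 'rV[R]_n) (x y z : 'cV[R]_n).

Let mul_lin g (s t : R) y z :
  (g *m (s *: y + t *: z)) 0 0 = s * (g *m y) 0 0 + t * (g *m z) 0 0.
Proof. by rewrite mulmxDr -!scalemxAr [LHS]mxE; congr (_ + _); rewrite mxE. Qed.

Let mul_sub g y z : (g *m (y - z)) 0 0 = (g *m y) 0 0 - (g *m z) 0 0.
Proof. by rewrite mulmxBr [LHS]mxE; congr (_ + _); rewrite mxE. Qed.

(** The Hahn-Banach argument, one coordinate at a time: a linear minorant on the
    span of the first [k] basis vectors extends to the next one, [e], because the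
    lower bounds for its value at [e] (collected in [S]) lie below the upper
    bounds, by convexity. *)
Lemma minorant_at0 v : cvx v -> v 0 = 0 ->
  exists g, forall y, (g *m y) 0 0 <= v y.
Proof.
move=> cv v0.
suff H k : (k <= n)%N -> exists g, forall y,
    (forall i : 'I_n, (k <= i)%N -> y i 0 = 0) -> (g *m y) 0 0 <= v y.
  have [g hg] := H n (leqnn n); exists g => y; apply: hg => i.
  by rewrite leqNgt ltn_ord.
elim: k => [_|k ih kn].
  exists 0 => y y0; rewrite (_ : y = 0) ?v0 ?mulmx0 ?mxE//.
  by apply/colP => i; rewrite mxE y0.
have [g hg] := ih (ltnW kn).
pose k0 := Ordinal kn; pose e : 'cV[R]_n := delta_mx k0 0.
pose V := [set y : 'cV[R]_n | forall i : 'I_n, (k <= i)%N -> y i 0 = 0].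
pose S := [set r : R | exists y t, [/\ V y, 0 < t &
  r = ((g *m y) 0 0 - v (y - t *: e)) / t]].
have Sub y z (s t : R) : V y -> V z -> 0 < s -> 0 < t ->
    ((g *m y) 0 0 - v (y - t *: e)) / t <= (v (z + s *: e) - (g *m z) 0 0) / s.
  move=> Vy Vz s0 t0; have st : 0 < s + t by rewrite addr_gt0.
  rewrite ler_pdivrMr// mulrAC ler_pdivlMr//.
  pose w := s / (s + t).
  have w01 : 0 <= w <= 1.
    by rewrite /w divr_ge0 ?(ltW s0) ?(ltW st)//= ler_pdivrMr// mul1r lerDl ltW.
  have w1 : 1 - w = t / (s + t) by rewrite /w; field; rewrite gt_eqF.
  have := cv w (y - t *: e) (z + s *: e) w01.
  have -> : w *: (y - t *: e) + (1 - w) *: (z + s *: e) = w *: y + (1 - w) *: z.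
    by apply/colP => i; rewrite !mxE /w; field; rewrite gt_eqF.
  have Vw : V (w *: y + (1 - w) *: z).
    by move=> i ki; rewrite !mxE Vy// Vz// !mulr0 addr0.
  move=> /(le_trans (hg _ Vw)); rewrite mul_lin w1 /w.
  set G := (g *m y) 0 0; set H := (g *m z) 0 0; set a := v _; set b := v _ => h.
  have {h} : (s + t) * (s / (s + t) * G + t / (s + t) * H) <=
      (s + t) * (s / (s + t) * a + t / (s + t) * b) by rewrite ler_pM2l.
  have E p q : (s + t) * (s / (s + t) * p + t / (s + t) * q) = s * p + t * q.
    by field; rewrite gt_eqF.
  rewrite !E; lra.
have V0 : V 0 by move=> i _; rewrite mxE.
have S0 : S !=set0.
  by exists (((g *m (0 : 'cV[R]_n)) 0 0 - v (0 - 1 *: e)) / 1); exists 0, 1.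
have ubS z s : V z -> 0 < s -> ubound S ((v (z + s *: e) - (g *m z) 0 0) / s).
  by move=> Vz s0 _ [y [t [Vy t0 ->]]]; exact: Sub.
pose c := sup S.
exists (g + (c - g 0 k0) *: delta_mx 0 k0) => y yk.
pose tau := y k0 0; pose y' := y - tau *: e.
have Vy' : V y'.
  move=> i; rewrite leq_eqVlt => /orP[/eqP ki|ki].
    have -> : i = k0 by apply/val_inj.
    by rewrite !mxE !eqxx mulr1 subrr.
  rewrite !mxE yk// -[i == k0]/(i == k :> nat) gtn_eqF//= mulr0 subr0//.
have yE : y = y' + tau *: e by rewrite subrK.
have -> : ((g + (c - g 0 k0) *: delta_mx 0 k0) *m y) 0 0 = (g *m y') 0 0 + c * tau.
  have dE : ((delta_mx 0 k0 : 'rV[R]_n) *m y) 0 0 = tau by rewrite -rowE mxE.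
  have gE : (g *m y) 0 0 = (g *m y') 0 0 + tau * g 0 k0.
    rewrite {1}yE mulmxDr [LHS]mxE -scalemxAr; congr (_ + _).
    by rewrite mxE -colE mxE.
  rewrite mulmxDl [LHS]mxE gE -scalemxAl [X in _ + X = _]mxE dE; ring.
have [t0|t0|t0] := ltgtP tau 0.
- have : ((g *m y') 0 0 - v (y' - (- tau) *: e)) / (- tau) <= c.
    apply: ub_le_sup; first by eexists; exact: (ubS 0 1).
    by exists y', (- tau); split; rewrite // oppr_gt0.
  rewrite scaleNr opprK -yE ler_pdivrMr ?oppr_gt0//; lra.
- have : c <= (v (y' + tau *: e) - (g *m y') 0 0) / tau.
    by apply: ge_sup => //; exact: ubS.
  rewrite -yE ler_pdivlMr//; lra.
- by rewrite t0 mulr0 addr0 yE t0 scale0r addr0; exact: hg.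
Qed.

Lemma affine_minorant u x : cvx u ->
  exists a : aff R n, ev a x = u x /\ forall y, ev a y <= u y.
Proof.
move=> cu; pose v y := u (x + y) - u x.
have cv : cvx v.
  move=> t y z t01; rewrite /v.
  have -> : x + (t *: y + (1 - t) *: z) = t *: (x + y) + (1 - t) *: (x + z).
    by apply/colP => i; rewrite !mxE; ring.
  by have := cu t (x + y) (x + z) t01; lra.
have [|g hg] := minorant_at0 cv; first by rewrite /v addr0 subrr.
exists (Aff g (u x - (g *m x) 0 0)); split=> [|y]; first by rewrite /ev/= addrC subrK.
have := hg (y - x); rewrite /v (addrC x) subrK mul_sub /ev/=; lra.
Qed.

(** If [u] exceeds [u x] by at most [A] at points close to [x + e_i] and [x - e_i] for
    all [i], then the sum of the absolute values of the coordinates of a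
    subgradient at [x] is at most [2 n A]. The tolerance [1 / (2 n)] makes the
    perturbation cost at most half of that sum. *)
Lemma cvx_lipschitz_at u x (A rho : R) z : cvx u ->
  (forall (i : 'I_n) (s : bool), exists v : 'cV[R]_n,
     (forall j, `|v j 0 - x j 0 - (-1) ^+ s * (i == j)%:R| <= (2 * n%:R)^-1) /\
     u v - u x <= A) ->
  (forall j, `|z j 0 - x j 0| <= rho) ->
  u x - u z <= 2 * n%:R * A * rho.
Proof.
move=> cu hA zx; have [[g c]/=] := affine_minorant x cu.
rewrite /ev/= => -[gx gle].
pose N : R := \sum_j `|g 0 j|.
have N0 : 0 <= N by apply: sumr_ge0.
have gsum (w : 'cV[R]_n) (e : R) : (forall j, `|w j 0| <= e) -> `|(g *m w) 0 0| <= N * e.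
  move=> we; rewrite mxE mulr_suml; apply: le_trans (ler_norm_sum _ _ _) _.
  by apply: ler_sum => j _; rewrite normrM ler_wpM2l.
have coord i (s : bool) : (-1) ^+ s * g 0 i <= A + N * (2 * n%:R)^-1.
  have [v [vx vA]] := hA i s.
  pose w := v - x - (-1) ^+ s *: delta_mx i 0.
  have : `|(g *m w) 0 0| <= N * (2 * n%:R)^-1.
    by apply: gsum => j; have := vx j; rewrite !mxE [j == i]eq_sym andbT.
  have dE : (g *m ((-1) ^+ s *: delta_mx i 0 : 'cV[R]_n)) 0 0 = (-1) ^+ s * g 0 i.
    by rewrite -scalemxAr mxE -colE mxE.
  rewrite /w !mul_sub dE ler_norml => /andP[h _].
  have := gle v; lra.
have [n0|n0] := posnP n.
  have zE : z = x by apply/colP => j; have nj := leq_ltn_trans (leq0n j) (ltn_ord j);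
    rewrite n0 in nj.
  by rewrite zE subrr n0 mulr0 !mul0r.
have n0' : 0 < n%:R :> R by rewrite ltr0n.
have NA : N <= 2 * n%:R * A.
  have : N <= \sum_(j < n) (A + N * (2 * n%:R)^-1).
    apply: ler_sum => j _; rewrite ler_norml; apply/andP; split.
      by have := coord j true; rewrite expr1; lra.
    by have := coord j false; rewrite expr0; lra.
  rewrite sumr_const card_ord -[X in _ <= X -> _]mulr_natl mulrDr.
  have -> : n%:R * (N * (2 * n%:R)^-1) = N / 2 by field; rewrite gt_eqF.
  lra.
have rho0 : 0 <= rho by apply: le_trans (zx (Ordinal n0)).
have : `|(g *m (z - x)) 0 0| <= N * rho by apply: gsum => j; have := zx j; rewrite !mxE.
rewrite mul_sub ler_norml => /andP[h _].
have : N * rho <= 2 * n%:R * A * rho by apply: ler_wpM2r.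
have := gle z; lra.
Qed.

End Subgradient.

(** * Convergence of convex functions and density *)

Section Density.
Context {R : realType} {n : nat}.
Implicit Types (u v : 'cV[R]_n -> R) (x y z : 'cV[R]_n).

Lemma cvg_colP (x_ : nat -> 'cV[R]_n) x : x_ @ \oo --> x <->
  forall e : R, 0 < e -> \forall m \near \oo, forall j, `|x_ m j 0 - x j 0| <= e.
Proof.
split=> [xx e e0|h].
  apply: filter_forall => j.
  have := cvg_comp _ _ xx (@coord_continuous _ _ _ j 0 x).
  move=> /cvgrPdist_le/(_ _ e0); apply: filterS => m /=.
  by rewrite distrC.
apply/cvg_ballP => e e0; have := h _ (divr_gt0 e0 (ltr0n _ 2)); apply: filterS => m hm.
split=> // i j; rewrite (ord1 j) /ball/= distrC; apply: le_lt_trans (hm i) _.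
by rewrite ltr_pdivrMr// ltr_pMr// ltr1n.
Qed.

(** Recovery sequences for the points [x + e_i] and [x - e_i] bound the subgradients of [u_ m]
    at [x] uniformly in [m]; comparing [u_ m x] with the values along a
    recovery sequence for [x] gives the upper estimate. *)
Lemma cvx_pointwise_cvg (u_ : nat -> 'cV[R]_n -> R) u x :
  (forall m, cvx (u_ m)) ->
  (forall e, 0 < e -> \forall m \near \oo, u x - e <= u_ m x) ->
  (forall z, exists2 z_, z_ @ \oo --> z & (fun m => u_ m (z_ m)) @ \oo --> u z) ->
  (fun m => u_ m x) @ \oo --> u x.
Proof.
move=> cu lsc rec; apply/cvgrPdist_le => e e0.
pose vert (p : 'I_n * bool) : 'cV[R]_n := x + (-1) ^+ p.2 *: delta_mx p.1 0.
pose K := \sum_p `|u (vert p)|.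
have uK p : u (vert p) <= K.
  rewrite /K (bigD1 p)//= (le_trans (ler_norm _))// lerDl sumr_ge0//.
pose A := K + 1 - (u x - 1).
have [z_ zx uz] := rec x.
pose d := 2 * n%:R * `|A| + 1.
have d0 : 0 < d by rewrite ltr_wpDl// !mulr_ge0.
pose rho := e / (2 * d).
have rho0 : 0 < rho by rewrite divr_gt0// mulr_gt0.
have h1 : \forall m \near \oo, forall j, `|z_ m j 0 - x j 0| <= rho.
  by move/cvg_colP: zx => /(_ _ rho0).
have h2 : \forall m \near \oo, u_ m (z_ m) <= u x + e / 2.
  by move: (uz) => /cvgr_le; apply; rewrite ltrDl divr_gt0.
have h3 : \forall m \near \oo, forall p : 'I_n * bool, exists v : 'cV[R]_n,
    (forall j, `|v j 0 - x j 0 - (-1) ^+ p.2 * (p.1 == j)%:R| <= (2 * n%:R)^-1) /\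
    u_ m v <= K + 1.
  apply: filter_forall => p; have [w_ wv uw] := rec (vert p).
  have n0 : (0 < n)%N := leq_ltn_trans (leq0n _) (ltn_ord p.1).
  have hn : 0 < (2 * n%:R)^-1 :> R by rewrite invr_gt0 mulr_gt0// ltr0n.
  have k1 : \forall m \near \oo, forall j, `|w_ m j 0 - vert p j 0| <= (2 * n%:R)^-1.
    by move/cvg_colP: wv => /(_ _ hn).
  have k2 : \forall m \near \oo, u_ m (w_ m) <= K + 1.
    by move: (uw) => /cvgr_le; apply; rewrite ltr_pwDr// uK.
  near=> m; exists (w_ m); split; last by near: m.
  move=> j; have : forall j, `|w_ m j 0 - vert p j 0| <= (2 * n%:R)^-1 by near: m.
  by move=> /(_ j); rewrite !mxE [j == _]eq_sym andbT opprD addrA.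
have h4 := lsc _ ltr01; have h5 := lsc _ e0.
near=> m; rewrite distrC ler_norml; apply/andP; split.
  have : u x - e <= u_ m x by near: m.
  lra.
have hx : u x - 1 <= u_ m x by near: m.
have : u_ m x - u_ m (z_ m) <= 2 * n%:R * A * rho.
  apply: cvx_lipschitz_at => //; last by near: m.
  move=> i s; have : forall p : 'I_n * bool, exists v : 'cV[R]_n,
    (forall j, `|v j 0 - x j 0 - (-1) ^+ p.2 * (p.1 == j)%:R| <= (2 * n%:R)^-1) /\
    u_ m v <= K + 1 by near: m.
  move=> /(_ (i, s))[v [vx vK]]; exists v; split=> //.
  by rewrite /A; lra.
have : u_ m (z_ m) <= u x + e / 2 by near: m.
have : 2 * n%:R * A * rho <= e / 2.
  apply: le_trans (_ : d * rho <= _); last first.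
    by rewrite /rho le_eqVlt; apply/orP; left; apply/eqP; field; rewrite gt_eqF.
  rewrite ler_pM2r// /d; apply: le_trans (_ : 2 * n%:R * `|A| <= _).
    by rewrite ler_wpM2l ?mulr_ge0// ler_norm.
  by rewrite lerDl.
lra.
Unshelve. all: by end_near.
Qed.

(** The translates [z |-> u (z + (x_ m - x))] satisfy the hypotheses of
    [cvx_pointwise_cvg]. *)
Lemma cvx_continuous u (x_ : nat -> 'cV[R]_n) x : cvx u -> x_ @ \oo --> x ->
  (fun m => u (x_ m)) @ \oo --> u x.
Proof.
move=> cu xx.
have := @cvx_pointwise_cvg (fun m z => u (z + (x_ m - x))) u x.
rewrite (_ : (fun m => u (x + _)) = (fun m => u (x_ m))); last first.
  by apply/funext => m; rewrite addrC subrK.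
apply.
- move=> m t y z t01.
  have -> : t *: y + (1 - t) *: z + (x_ m - x) =
      t *: (y + (x_ m - x)) + (1 - t) *: (z + (x_ m - x)).
    by apply/colP => i; rewrite !mxE; ring.
  exact: cu.
- move=> e e0; have [a [ax aleu]] := affine_minorant x cu.
  have : (fun m => ev a (x_ m)) @ \oo --> ev a x.
    by apply: cvgD; [exact: cvg_mulrv|exact: cvg_cst].
  move=> /cvgr_ge/(_ (u x - e)); rewrite ax ltrBlDr ltrDl => /(_ e0).
  by apply: filterS => m h; rewrite (addrC x) subrK; exact: le_trans h _.
- move=> z; exists (fun m => z - (x_ m - x)).
    rewrite -[X in _ --> X]subr0 -[in X in _ --> X](subrr x).
    by apply: cvgB; [exact: cvg_cst|apply: cvgB => //; exact: cvg_cst].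
  by under eq_fun do rewrite subrK; exact: cvg_cst.
Qed.

Context (mu : ('cV[R]_n -> R) -> R) (muP : invariant_valuation mu)
  (mu0 : mu (fun=> 0) = 0).

(** Approximate [u] by maxima of tangents at the first [m + 1] rational points. The
    tangent at [q] is at least [2 * u q - u (2 *: q - x)] at [x], because it lies
    below [u] at the reflected point; this tends to [u x] as [q --> x]. *)
Lemma mu_cvx0 u : (2 < n)%N -> cvx u -> mu u = 0.
Proof.
move=> n3 cu.
have [T hT] : {T : 'cV[R]_n -> aff R n &
    forall q, ev (T q) q = u q /\ forall y, ev (T q) y <= u y}.
  apply: (@choice _ _ (fun q a => ev a q = u q /\ forall y, ev a y <= u y)) => q.
  exact: affine_minorant.
pose pt (j : nat) : 'cV[R]_n :=
  map_mx ratr (odflt 0 (unpickle j : option 'cV[rat]_n)).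
pose U m := maxaff [seq T (pt j) | j <- iota 0 m.+1].
have Ule m x : U m x <= u x.
  by rewrite maxaff_le//; apply/allP => _ /mapP[j _ ->]; exact: (hT _).2.
have Tlow q x : 2 * u q - u (2 *: q - x) <= ev (T q) x.
  have [Tq Tle] := hT q; have := Tle (2 *: q - x).
  have : ev (T q) (2 *: q - x) = 2 * ev (T q) q - ev (T q) x.
    have := ev_conv (T q) 2^-1 (2 *: q - x) x.
    have -> : 2^-1 *: (2 *: q - x) + (1 - 2^-1) *: x = q.
      by apply/colP => i; rewrite !mxE; field.
    lra.
  rewrite Tq; lra.
have dense x e : 0 < e -> exists j, u x - e < ev (T (pt j)) x.
  move=> e0.
  have [Q hQ] : {Q : nat -> 'cV[rat]_n & forall m i,
      x i 0 < ratr (Q m i 0) < x i 0 + m.+1%:R^-1}.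
    apply: (@choice _ _ (fun m (q : 'cV[rat]_n) => forall i,
      x i 0 < ratr (q i 0) < x i 0 + m.+1%:R^-1)) => m.
    have [f hf] : {f : 'I_n -> rat & forall i, x i 0 < ratr (f i) < x i 0 + m.+1%:R^-1}.
      apply: (@choice _ _ (fun i r => x i 0 < ratr r < x i 0 + m.+1%:R^-1)) => i.
      have lt_x : x i 0 < x i 0 + m.+1%:R^-1 by rewrite ltrDl invr_gt0.
      have [r] := rat_in_itvoo lt_x.
      by rewrite in_itv; exists r.
    by exists (\col_i f i) => i; rewrite mxE.
  pose q m : 'cV[R]_n := map_mx ratr (Q m).
  have qx : q @ \oo --> x.
    apply/cvg_colP => d d0; near=> m => j.
    have /andP[h1 h2] := hQ m j; rewrite mxE ger0_norm ?subr_ge0 ?(ltW h1)//.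
    have : m.+1%:R^-1 < d by near: m; exact: near_infty_natSinv_lt (PosNum d0).
    move: h2; set r := _ ^-1; lra.
  have : (fun m => 2 * u (q m) - u (2 *: q m - x)) @ \oo --> 2 * u x - u (2 *: x - x).
    apply: cvgB; first by apply: cvgM; [exact: cvg_cst|exact: cvx_continuous].
    apply: cvx_continuous => //; apply: cvgB; last exact: cvg_cst.
    exact: cvgZr.
  have -> : 2 *: x - x = x by apply/colP => i; rewrite !mxE; ring.
  have -> : 2 * u x - u x = u x by ring.
  move=> /cvgr_gt/(_ (u x - e)); rewrite ltrBlDr ltrDl => /(_ e0).
  case=> N _ /(_ N (leqnn N)) /= hN.
  exists (pickle (Q N)); apply: lt_le_trans hN _.
  by rewrite /pt pickleK; exact: Tlow.
have cv : (fun m => mu (U m)) @ \oo --> mu u.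
  apply: (iv_cts muP) => // [m|x_ x xx]; first exact: cvx_maxaff.
  have ux := cvx_continuous cu xx.
  apply/cvgrPdist_le => e e0.
  have e2 : 0 < e / 2 by rewrite divr_gt0.
  have [j hj] := dense x _ e2.
  have Tx : (fun m => ev (T (pt j)) (x_ m)) @ \oo --> ev (T (pt j)) x.
    by apply: cvgD; [exact: cvg_mulrv|exact: cvg_cst].
  near=> m.
  have jm : (j < m.+1)%N by near: m; exists j.
  have h1 : u (x_ m) <= u x + e.
    by near: m; move: (ux) => /cvgr_le; apply; rewrite ltrDl.
  have h2 : u x - e <= ev (T (pt j)) (x_ m).
    near: m; move: (Tx) => /cvgr_ge; apply; apply: lt_trans hj; lra.
  have h3 : ev (T (pt j)) (x_ m) <= U m (x_ m).
    by apply: maxaff_ge; apply/mapP; exists j; rewrite // mem_iota.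
  have h4 := Ule m (x_ m).
  by rewrite ler_norml; apply/andP; split; lra.
apply: (cvg_unique (@norm_hausdorff _ _) cv).
rewrite (_ : (fun m => _) = fun=> 0); first exact: cvg_cst.
by apply/funext => m; exact: mu_maxaff0.
Unshelve. all: by end_near.
Qed.

End Density.

(** * From log-concave functions to invariant valuations *)

Section LogConcave.
Context {R : realType} {n : nat}.
Implicit Types (u v : 'cV[R]_n -> R) (x y z : 'cV[R]_n) (f : LC R n).

Lemma cvx_convex_function u :
  cvx u <-> @convex_function R 'cV[R]_n [set: 'cV[R]_n] u.
Proof.
split=> [cu t x y _ _|cu t x y /andP[t0 t1]].
  by apply: cu; rewrite ge0 le1.
by have := cu (Itv01 t0 t1) x y; rewrite !in_setT => /(_ isT isT).
Qed.

Lemma log_concave_expR u : cvx u -> log_concave (fun x => expR (- u x)).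
Proof. by move=> /cvx_convex_function cu; exists u. Qed.

Lemma LC_gt0 f x : 0 < f x.
Proof. by have [u _ ->] := LC_funP f; exact: expR_gt0. Qed.

Lemma LC_cvx f : cvx (fun x => - ln (f x)).
Proof.
have [u cu ->] := LC_funP f; rewrite (_ : (fun x => _) = u).
  exact/cvx_convex_function.
by apply/funext => x /=; rewrite expRK opprK.
Qed.

Lemma LC_eq f (g : LC R n) : LC_fun f =1 g -> f = g.
Proof.
case: f g => [f fP] [g gP] /= /funext fg; rewrite fg in fP *.
by congr MkLC; exact: Prop_irrelevance.
Qed.

Lemma limn_einf_ge_near (a : nat -> R) (l e : R) : 0 < e ->
  (l%:E <= limn_einf (fun i => (a i)%:E))%E -> \forall i \near \oo, l - e <= a i.
Proof.
move=> e0; rewrite limn_einf_lim.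
set s := einfs _; have -> : limn s = ereal_sup (range s).
  by apply/cvg_lim => //; exact: cvg_einfs_sup.
move=> h; have : ((l - e)%:E < ereal_sup (range s))%E.
  by apply: lt_le_trans h; rewrite lte_fin ltrBlDr ltrDl.
move=> /ereal_sup_gt[_ [N _ <-]] hN; exists N => // i /= Ni.
rewrite -lee_fin; apply/ltW/(lt_le_trans hN); apply: ereal_inf_lbound.
by exists i.
Qed.

Lemma epi_cvg_of_continuous_cvg (u_ : nat -> 'cV[R]_n -> R) u :
  (forall (x_ : nat -> 'cV[R]_n) x, x_ @ \oo --> x ->
     (fun m => u_ m (x_ m)) @ \oo --> u x) -> epi_cvg u_ u.
Proof.
move=> h x; split=> [x_ /h ux|].
  have : (fun i => (u_ i (x_ i))%:E) @ \oo --> (u x)%:E.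
    by apply: cvg_EFin => //; near=> i.
  by move=> /cvg_limn_einf_sup[-> _].
exists (fun=> x); first exact: cvg_cst.
by apply: h; exact: cvg_cst.
Unshelve. all: by end_near.
Qed.

Lemma hypo_cvg_pointwise (f_ : nat -> LC R n) f x : hypo_cvg f_ f ->
  (fun m => f_ m x) @ \oo --> f x.
Proof.
move=> ff.
have : (fun m => - ln (f_ m x)) @ \oo --> - ln (f x).
  apply: (@cvx_pointwise_cvg _ _ (fun m x => - ln (f_ m x)) (fun x => - ln (f x))).
  - by move=> m; exact: LC_cvx.
  - move=> e e0; apply: limn_einf_ge_near => //.
    by apply: (ff x).1; exact: cvg_cst.
  - by move=> z; exact: (ff z).2.
have expK (g : LC R n) : g x = expR (- - ln (g x)) by rewrite opprK lnK// posrE LC_gt0.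
move=> h; rewrite expK; under eq_fun do rewrite expK.
by apply: continuous_cvg; [exact: continuous_expR | exact: cvgN].
Qed.

Context (Z : LC R n -> 'cV[R]_n -> R).

(** [u |-> Z (expR (- u)) 0], made total so as to be a functional on plain functions. *)
Definition value_at0 u : R :=
  if pselect (cvx u) is left cu then Z (MkLC (log_concave_expR cu)) 0 else 0.

Lemma value_at0E u f : cvx u -> (forall x, f x = expR (- u x)) ->
  value_at0 u = Z f 0.
Proof.
move=> cu fu; rewrite /value_at0; case: pselect => // cu'.
by congr (Z _ 0); apply: LC_eq => x /=; rewrite fu.
Qed.

Hypotheses (Zc : hypo_continuous Z) (ZSL : SL_covariant Z) (Zv : valuation Z)
  (Zt : translation_hom Z).

Lemma Z_value_at0 f x : Z f x = value_at0 (fun y => - ln (f (y + x))).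
Proof.
pose g := MkLC (translate_LC (- x) f).
have -> : Z f x = Z g 0.
  by rewrite /g (Zt f (- x)).1 /translate opprK add0r.
symmetry; apply: value_at0E => [|y].
  by have := LC_cvx g; rewrite /= /translate opprK.
by rewrite /= /translate !opprK lnK// posrE LC_gt0.
Qed.

(** Only the rule for constants is not immediate. Tilting by [q] between a
    translation by [- p] and one by [p], and then by [- q], multiplies [f] by
    [expR (dot p q)], and [Z f 0] by the same factor; a suitable choice of [p] and [q]
    produces any positive constant. *)
Lemma value_at0_invariant (n0 : (0 < n)%N) : invariant_valuation value_at0.
Proof.
split.
- move=> u a cu.
  pose f := MkLC (log_concave_expR cu).
  pose p : 'cV[R]_n := delta_mx (Ordinal n0) 0; pose q := - height a *: p.
  have dotE x b : dot x b = (b^T *m x) 0 0.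
    by rewrite /dot mxE; apply: eq_bigr => i _; rewrite mxE mulrC.
  have pq : dot p q = - height a.
    rewrite dotE /q linearZ/= -scalemxAl mxE trmx_delta -rowE !mxE !eqxx mulr1//.
  pose f1 := MkLC (translate_LC (- p) f); pose f2 := MkLC (tilt_LC q f1).
  pose f3 := MkLC (translate_LC p f2).
  pose f4 := MkLC (tilt_LC ((slope a)^T - q) f3).
  rewrite (@value_at0E _ f4); last 2 first.
  + by apply: cvx_add => //; exact: cvx_ev.
  + move=> x; rewrite /= /tilt /translate /= /tilt /translate /= opprK subrK.
    rewrite -!expRD; congr expR; rewrite /ev.
    have -> : dot (x - p) q = dot x q - dot p q.
      by rewrite !dotE mulmxBr [LHS]mxE; congr (_ + _); rewrite mxE.
    have -> : dot x ((slope a)^T - q) = (slope a *m x) 0 0 - dot x q.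
      rewrite !dotE linearB/= trmxK mulmxBl [LHS]mxE; congr (_ + _).
      by rewrite mxE.
    rewrite pq; ring.
  rewrite (Zt f3 _).2 /tilt (Zt f2 _).1 /translate (Zt f1 _).2 /tilt.
  rewrite (Zt f _).1 /translate sub0r addrN -(@value_at0E u f)//.
  have -> : dot 0 ((slope a)^T - q) = 0 by rewrite dotE mulmx0 mxE.
  have -> : dot (- p) q = height a.
    by rewrite dotE mulmxN mxE -dotE pq opprK.
  by rewrite oppr0 expR0 mul1r.
- move=> u phi cu phi1.
  have uphi : phi \in unitmx by rewrite unitmxE phi1 unitr1.
  have iphi1 : \det (invmx phi) = 1 by rewrite det_inv phi1 invr1.
  pose f := MkLC (log_concave_expR cu).
  rewrite (@value_at0E _ (MkLC (comp_inv_LC (invmx phi) f))); last 2 first.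
  + exact: cvx_comp.
  + by move=> x; rewrite /= /comp_inv invmxK.
  rewrite (ZSL f iphi1) /comp_inv mulmx0.
  by symmetry; apply: value_at0E.
- move=> u v cu cv cuv.
  pose f := MkLC (log_concave_expR cu); pose g := MkLC (log_concave_expR cv).
  have expR_min a b : expR (- Num.min a b) = Num.max (expR (- a)) (expR (- b)) :> R.
    by case: (leP a b) => ab; [rewrite max_l|rewrite max_r];
      rewrite // ler_expR lerN2// ltW.
  have expR_max a b : expR (- Num.max a b) = Num.min (expR (- a)) (expR (- b)) :> R.
    by case: (leP a b) => ab; [rewrite min_r|rewrite min_l];
      rewrite // ler_expR lerN2// ltW.
  have fg_max : log_concave (fun x => Num.max (f x) (g x)).
    have := log_concave_expR cuv; congr log_concave.
    by apply/funext => x; rewrite expR_min.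
  have fg_min : log_concave (fun x => Num.min (f x) (g x)).
    have := log_concave_expR (cvx_max cu cv); congr log_concave.
    by apply/funext => x; rewrite expR_max.
  rewrite (@value_at0E _ (MkLC fg_min)); [|exact: cvx_max|by move=> x; rewrite expR_max].
  rewrite (@value_at0E _ (MkLC fg_max)); [|exact: cuv|by move=> x; rewrite expR_min].
  by rewrite addrC Zv -(@value_at0E u f)// -(@value_at0E v g).
- move=> u_ u cu_ cu uu.
  pose f := MkLC (log_concave_expR cu).
  pose f_ m := MkLC (log_concave_expR (cu_ m)).
  have -> : value_at0 u = Z f 0 by apply: value_at0E.
  rewrite (_ : (fun m => _) = fun m => Z (f_ m) 0); last first.
    by apply/funext => m; exact: value_at0E.
  apply: Zc; apply: epi_cvg_of_continuous_cvg => x_ x xx /=.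
  by rewrite expRK opprK; under eq_fun do rewrite expRK opprK; exact: uu.
Qed.

End LogConcave.

(** Evaluation at the origin is itself an invariant valuation; subtracting the
    right multiple of it from [mu] makes [mu] vanish at the zero function. *)
Lemma invariant_valuation_sub_eval0 {R : realType} {n : nat}
    (mu : ('cV[R]_n -> R) -> R) (c : R) :
  invariant_valuation mu ->
  invariant_valuation (fun u => mu u - c * expR (- u 0)).
Proof.
move=> muP; split.
- move=> u a cu; rewrite (iv_affine muP)// /ev mulmx0 mxE add0r opprD expRD; ring.
- by move=> u phi cu phi1; rewrite (iv_SL muP)// mulmx0.
- move=> u v cu cv cuv; have := iv_val muP cu cv cuv.
  have : expR (- Num.max (u 0) (v 0)) + expR (- Num.min (u 0) (v 0)) =
      expR (- u 0) + expR (- v 0).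
    by case: (leP (u 0) (v 0)) => _ //; rewrite addrC.
  nra.
- move=> u_ u cu_ cu uu; apply: cvgB; first exact: (iv_cts muP).
  apply: cvgM; first exact: cvg_cst.
  apply: continuous_cvg; first exact: continuous_expR.
  by apply: cvgN; apply: (uu (fun=> 0)); exact: cvg_cst.
Qed.

Theorem theorem6p2 (R : realType) (n : nat) (hn : (3 <= n)%N)
    (Z : LC R n -> 'cV[R]_n -> R) :
  [/\ hypo_continuous Z, SL_covariant Z, valuation Z & translation_hom Z] <->
  exists c : R, forall f : LC R n, Z f = (fun x => c * f x).
Proof.
split=> [[Zc ZSL Zv Zt]|[c Zf]].
  have n0 : (0 < n)%N by exact: leq_trans hn.
  have muP := value_at0_invariant Zc ZSL Zv Zt n0.
  pose c := value_at0 Z (fun=> 0); exists c => f; apply/funext => x.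
  rewrite (Z_value_at0 Zt).
  set u := fun y => - ln _.
  have cu : cvx u.
    have := LC_cvx (MkLC (translate_LC (- x) f)); rewrite /= /translate.
    by under eq_fun do rewrite opprK.
  have := mu_cvx0 (invariant_valuation_sub_eval0 c muP) _ hn cu.
  rewrite oppr0 expR0 mulr1 subrr => /(_ erefl)/eqP.
  by rewrite subr_eq0 => /eqP ->; rewrite /u add0r opprK lnK// posrE LC_gt0.
split.
- move=> f_ f ff x; rewrite Zf; under eq_fun do rewrite Zf.
  by apply: cvgM; [exact: cvg_cst | exact: hypo_cvg_pointwise].
- by move=> f phi phi1; rewrite !Zf.
- move=> f g fgmax fgmin x; rewrite !Zf -!mulrDr /=; congr (_ * _).
  by case: (leP (f x) (g x)) => // _; rewrite addrC.
- move=> f y; rewrite !Zf; split=> //; apply/funext => x.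
  by rewrite /= /tilt mulrCA.
Qed.
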